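(* Let $B=2^{k_1}C_1\perp\cdots\perp2^{k_r}C_r\in\mathcal H_n(\mathfrak o)$ be a pre-optimal form and $n_r=\deg C_r$. Then there is an optimal basis $\{\phi_1,\ldots,\phi_n\}$ of $L_B$ such that $\{\phi_1,\ldots,\phi_{n-n_r}\}$ is an optimal basis of $L_{B^{[r-1]}}$.
   Context: Let $F$ be a finite unramified extension of $\mathbb Q_2$ with ring of integers $\mathfrak o$, $\mathrm{ord}$ the valuation with $\mathrm{ord}(2)=1$, $\mathrm{ord}(0)=+\infty$. $\mathcal H_n(\mathfrak o)$ is the set of symmetric $B=(b_{ij})\in M_n(F)$ with $b_{ii}\in\mathfrak o$, $2b_{ij}\in\mathfrak o$. $\perp$ is block-diagonal sum. For nondegenerate $B$ of degree $n$: $D_B=(-4)^{[n/2]}\det B$; $\xi_B=1,-1,0$ according as $D_B\in F^{\times2}$, $F(\sqrt{D_B})/F$ unramified quadratic, or ramified. $S_2(\mathfrak o)_e$: symmetric $2\times2$ matrices over $\mathfrak o$ with diagonal in $2\mathfrak o$; unimodular diagonal: diagonal with unit entries. GK invariant: $S(B)$ = set of non-decreasing $(a_i)\in\mathbb Z_{\ge0}^n$ with $\mathrm{ord}(b_{ii})\ge a_i$, $\mathrm{ord}(2b_{ij})\ge(a_i+a_j)/2$ ($1\le i\le j\le n$); $\mathrm{GK}(B)$ = lexicographically greatest element of $\bigcup_{U\in GL_n(\mathfrak o)}S({}^tUBU)$; $B$ optimal if $\mathrm{GK}(B)\in S(B)$. Quadratic modules: for $B\in\mathcal H_n(\mathfrak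 o)$, $L_B$ is a free $\mathfrak o$-module with basis $\psi_1,\dots,\psi_n$ and quadratic form $Q$ whose bilinear form $(x,y)=Q(x+y)-Q(x)-Q(y)$ satisfies $\frac12(\psi_i,\psi_j)=b_{ij}$. A basis $u_1,\dots,u_n$ is optimal if $(\frac12(u_i,u_j))$ is optimal. For $B=B_1\perp B_2$ with $\deg B_1=n_1$, $L_{B_1}$ is the submodule spanned by $\psi_1,\dots,\psi_{n_1}$. Pre-optimal forms: $B=2^{k_1}C_1\perp\cdots\perp2^{k_r}C_r$ with $k_i\ge0$, each $C_i$ unimodular diagonal or in $\frac12(S_2(\mathfrak o)_e\cap GL_2(\mathfrak o))$; $B^{[j]}=2^{k_1}C_1\perp\cdots\perp2^{k_j}C_j$; $\mathcal D_m=\{j:k_j=m,C_j\text{ diagonal}\}$, $\mathcal E_m=\{j:k_j=m,C_j\text{ not diagonal}\}$. Pre-optimal means: (PO1) $\sum_{j\in\mathcal D_m}\deg C_j\le2$ and $\mathcal E_m$ is a (possibly empty) set of consecutive integers, for each $m$; (PO2) for $i<j$: $i\in\mathcal D_{m_1},j\in\mathcal D_{m_2}\Rightarrow m_1\le m_2$; $i\in\mathcal E_{m_1},j\in\mathcal E_{m_2}\Rightarrow m_1\le m_2$; $i\in\mathcal D_{m_1},j\in\mathcal E_{m_2}\Rightarrow m_1\le m_2-1$; $i\in\mathcal E_{m_1},j\in\mathcal D_{m_2}\Rightarrow m_1\le m_2+1$; (PO3) if $C_i$ is unimodular diagonal of degree 2 then $i\ge2$ and either ($\deg B^{[i]}$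 even and $\xi_{B^{[i-1]}}=\xi_{B^{[i]}}=0$) or ($\deg B^{[i-1]}$ odd and $\mathrm{ord}\det B^{[i-1]}+k_i$ even); (PO4) if $k_i=k_{i-1}-1$, $C_i$ diagonal, $C_{i-1}$ not diagonal, then $\deg C_i=2$, or $\deg C_i=1$ and either ($\deg B^{[i]}$ and $\mathrm{ord}\det B^{[i]}$ even) or ($\deg B^{[i]}$ odd and $\xi_{B^{[i-1]}}=0$); (PO5) if $C_i$ diagonal, $C_{i+1}$ not diagonal, $k_i=k_{i+1}-1$, then $\deg C_i=1$ and either ($\deg B^{[i]}$ even and $\mathrm{ord}\det B^{[i]}$ odd) or ($\deg B^{[i]}$ odd and $\xi_{B^{[i-1]}}\ne0$ if $i\ge2$); (PO6) if $\deg B^{[i]}$ even, $C_i,C_{i+1}$ unimodular diagonal, $k_{i+1}=k_i+1$, then $\xi_{B^{[i]}}=0$. *)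

(* Defs.v *)
From HB Require Import structures.
From mathcomp Require Import all_boot all_order all_algebra.
Set Implicit Arguments. Unset Strict Implicit. Unset Printing Implicit Defensive.
Import Order.TTheory GRing.Theory Num.Theory.
Local Open Scope ring_scope.

Section Defs.
Variables (F : fieldType) (v : F -> int).
(* v is the valuation ord on F^x (v 0 is irrelevant junk; ord(0) = +oo is
   handled by the predicates below). *)

(* ord x >= k, with the convention ord 0 = +oo *)
Definition ord_ge (x : F) (k : int) : Prop := x = 0 \/ k <= v x.
Definition in_o (x : F) : Prop := ord_ge x 0.
Definition unit_o (x : F) : Prop := x != 0 /\ v x = 0.

Definition residue_finite : Prop :=
  exists s : seq F, (forall y, y \in s -> in_o y) /\
    forall x, in_o x -> exists2 y, y \in s & ord_ge (x - y) 1.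

Definition v_complete : Prop :=
  forall u : nat -> F,
    (forall N : int, exists M, forall p q, (M <= p)%N -> (M <= q)%N -> ord_ge (u p - u q) N) ->
    exists l, forall N : int, exists M, forall p, (M <= p)%N -> ord_ge (u p - l) N.

(* (F, v) is a finite unramified extension of Q_2 with its normalized valuation:
   a complete discretely valued field of characteristic 0 in which 2 is a
   uniformizer (ord 2 = 1) and with finite residue field. *)
Record unram2adic : Prop := {
  u2_char0 : [pchar F] =i pred0;
  u2_mul : forall x y, x != 0 -> y != 0 -> v (x * y) = v x + v y;
  u2_add : forall x y, x != 0 -> y != 0 -> x + y != 0 -> Num.min (v x) (v y) <= v (x + y);
  u2_two : v 2 = 1;
  u2_res : residue_finite;
  u2_complete : v_complete }.

Definition in_Hn n (B : 'M[F]_n) : Prop :=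
  B^T = B /\ (forall i, in_o (B i i)) /\ (forall i j, in_o (2 * B i j)).

Definition in_GLo n (U : 'M[F]_n) : Prop :=
  (forall i j, in_o (U i j)) /\ unit_o (\det U).

Definition in_S n (B : 'M[F]_n) (a : 'I_n -> nat) : Prop :=
  (forall i j : 'I_n, (i <= j)%N -> (a i <= a j)%N) /\
  (forall i : 'I_n, ord_ge (B i i) (a i)%:Z) /\
  (forall i j : 'I_n, (i <= j)%N ->
      2 * B i j = 0 \/ ((a i + a j)%N%:Z <= 2 * v (2 * B i j))).

Definition lex_le n (a b : 'I_n -> nat) : Prop :=
  a =1 b \/ exists i : 'I_n, (a i < b i)%N /\ forall j : 'I_n, (j < i)%N -> a j = b j.

Definition is_GK n (B : 'M[F]_n) (a : 'I_n -> nat) : Prop :=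
  (exists U, in_GLo U /\ in_S (U^T *m B *m U) a) /\
  forall U a', in_GLo U -> in_S (U^T *m B *m U) a' -> lex_le a' a.

Definition optimal n (B : 'M[F]_n) : Prop := exists a, is_GK B a /\ in_S B a.

Definition is_sq (x : F) : Prop := exists y, x = y ^+ 2.

(* F(sqrt D)/F is an unramified quadratic extension: D is not a square and the
   (unique) extension of ord to F(sqrt D), x |-> ord(N x)/2, has value group Z,
   i.e. norms a^2 - D b^2 of nonzero elements have even valuation. *)
Definition unram_quad (D : F) : Prop :=
  ~ is_sq D /\ forall a b : F, (a != 0 \/ b != 0) -> ~~ odd `|v (a ^+ 2 - D * b ^+ 2)|%N.

Definition xi_val (D : F) (e : int) : Prop :=
  (e = 1 /\ D != 0 /\ is_sq D) \/
  (e = -1 /\ D != 0 /\ unram_quad D) \/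
  (e = 0 /\ D != 0 /\ ~ is_sq D /\ ~ unram_quad D).

Definition DB n (B : 'M[F]_n) : F := (-4) ^+ (n./2) * \det B.

(* BDiag k us : 2^k * diag(us);  BNon k a b c : 2^k * (1/2) [[2a, b],[b, 2c]] *)
Inductive blk := BDiag of nat & seq F | BNon of nat & F & F & F.

Definition blk_k (b : blk) : nat := match b with BDiag k _ => k | BNon k _ _ _ => k end.
Definition blk_deg (b : blk) : nat := match b with BDiag _ us => size us | BNon _ _ _ _ => 2 end.
Definition blk_isdiag (b : blk) : bool := if b is BDiag _ _ then true else false.

Definition blk_wf (b : blk) : Prop :=
  match b with
  | BDiag _ us => (0 < size us)%N /\ forall x, x \in us -> unit_o x
  | BNon _ a b c => in_o a /\ in_o b /\ in_o c /\ unit_o (4 * a * c - b ^+ 2)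
  end.

Definition blk_entry (b : blk) (i j : nat) : F :=
  match b with
  | BDiag k us => if i == j then 2 ^+ k * nth 0 us i else 0
  | BNon k a b c =>
      2 ^+ k * (if (i == 0%N) && (j == 0%N) then a
                else if (i == 1%N) && (j == 1%N) then c else b / 2)
  end.

Fixpoint bmat (bs : seq blk) (i j : nat) : F :=
  match bs with
  | [::] => 0
  | b :: bs' =>
      let d := blk_deg b in
      if (i < d)%N && (j < d)%N then blk_entry b i j
      else if (d <= i)%N && (d <= j)%N then bmat bs' (i - d) (j - d) else 0
  end.

Definition totdeg (bs : seq blk) : nat := sumn (map blk_deg bs).

Definition mxn n (f : nat -> nat -> F) : 'M[F]_n := \matrix_(i < n, j < n) f i j.

Definition Bof (bs : seq blk) : 'M[F]_(totdeg bs) := mxn (totdeg bs) (bmat bs).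

Section PO.
Variable bs : seq blk.
(* 1-indexed access to blocks and to B^[j] *)
Let r := size bs.
Let bk (i : nat) := nth (BDiag 0 [::]) bs i.-1.
Let kk i := blk_k (bk i).
Let isD i := blk_isdiag (bk i).
Let dg i := blk_deg (bk i).
Let degpre j := totdeg (take j bs).
Let detpre j := \det (Bof (take j bs)).
Let xi j (e : int) := xi_val (DB (Bof (take j bs))) e.

Definition PO1 : Prop :=
  (forall m, (\sum_(b <- bs | blk_isdiag b && (blk_k b == m)) blk_deg b <= 2)%N) /\
  (forall m i j l, (1 <= i)%N -> (i < l)%N -> (l < j)%N -> (j <= r)%N ->
     ~~ isD i -> kk i = m -> ~~ isD j -> kk j = m -> ~~ isD l /\ kk l = m).

Definition PO2 : Prop :=
  forall i j, (1 <= i)%N -> (i < j)%N -> (j <= r)%N ->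
    [/\ (isD i -> isD j -> kk i <= kk j)%N,
        (~~ isD i -> ~~ isD j -> kk i <= kk j)%N,
        (isD i -> ~~ isD j -> kk i <= (kk j).-1 /\ 1 <= kk j)%N &
        (~~ isD i -> isD j -> kk i <= kk j + 1)%N].

Definition PO3 : Prop :=
  forall i, (1 <= i)%N -> (i <= r)%N -> isD i -> dg i = 2%N ->
    (2 <= i)%N /\
    ((~~ odd (degpre i) /\ xi i.-1 0 /\ xi i 0) \/
     (odd (degpre i.-1) /\ ~~ odd `|(v (detpre i.-1) + (kk i)%:Z)%R|%N)).

Definition PO4 : Prop :=
  forall i, (2 <= i)%N -> (i <= r)%N -> (kk i + 1 = kk i.-1)%N -> isD i -> ~~ isD i.-1 ->
    dg i = 2%N \/
    (dg i = 1%N /\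
     ((~~ odd (degpre i) /\ ~~ odd `|v (detpre i)|%N) \/
      (odd (degpre i) /\ xi i.-1 0))).

Definition PO5 : Prop :=
  forall i, (1 <= i)%N -> (i < r)%N -> isD i -> ~~ isD i.+1 -> (kk i + 1 = kk i.+1)%N ->
    dg i = 1%N /\
    ((~~ odd (degpre i) /\ odd `|v (detpre i)|%N) \/
     (odd (degpre i) /\ ((2 <= i)%N -> ~ xi i.-1 0))).

Definition PO6 : Prop :=
  forall i, (1 <= i)%N -> (i < r)%N -> ~~ odd (degpre i) -> isD i -> isD i.+1 ->
    (kk i.+1 = kk i + 1)%N -> xi i 0.

Definition preoptimal : Prop :=
  (forall i, (i < size bs)%N -> blk_wf (nth (BDiag 0 [::]) bs i)) /\ PO1 /\ PO2 /\ PO3 /\ PO4 /\ PO5 /\ PO6.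
End PO.

End Defs.

(* Main.v *)
Require Import Defs.
From HB Require Import structures.
From mathcomp Require Import all_boot all_order all_fingroup all_algebra zify ring.
From Stdlib Require Import Classical.
Set Implicit Arguments. Unset Strict Implicit. Unset Printing Implicit Defensive.
Import Order.TTheory GRing.Theory Num.Theory.
Local Open Scope ring_scope.

(** The Gram matrix is [A = 2B] and [D = (-1)^[n/2] det A].  Weights [a] in [S(B)]
    form a norm dominated by the quadratic form; splitting off planes on which
    the domination is sharp shows [|a| <= Delta(B)], where [Delta] depends only
    on [ord D] and on whether [D] is a square modulo 4, that is, on [xi].
    Equality also produces sharp vectors: nearly orthogonal to the lattice, with
    [Q] taking exactly the value given by the norm, and realising both parities
    when [n] is even and [xi = 0].

    Weights are saturated if [|a| = Delta] on every leading block at whose end they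
    jump; they are then [GK(B)].  Indeed, if [a'] were larger, first at [i], put
    [m = a_i + 1] and let [p] count the weights [< m].  Adjoining vectors dual to the
    last [n - p] basis vectors up to the factor [2^m] leaves only the determinant of
    the leading block of size [p], and the inequality for the weights [min(a', m)]
    fails there.

    A pre-optimal form is then treated block by block.  A non-diagonal block
    [2^k C] is appended with weights [(k, k)].  A diagonal vector of level [k] is
    corrected by sharp vectors of levels [k] and [k+1], which raises its weight to
    [k], [k+1] or [k+2], as dictated by [Delta].  The conditions (PO1)-(PO6) say
    that the weights obtained in this way are non-decreasing, except for two
    successive blocks of degree 1 with the same [k] whose weights would be [k+2]
    and [k]; correcting both vectors from the lattice before them gives
    [(k+1, k+1)], and the first one alone still has weight [k+2]. *)

Section Unramified2adic.
Variables (F : fieldType) (v : F -> int).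
Hypothesis Hv : unram2adic v.

(** * Valuations *)

Definition ord_eq (x : F) (k : int) : Prop := x != 0 /\ v x = k.

(* [2 ord x >= k]: doubling keeps the half-integral bounds [(a_i + a_j)/2] in [int] *)
Definition dord_ge (x : F) (k : int) : bool := (x == 0) || (k <= 2 * v x).

Lemma natr_neq0 n : (n.+1%:R : F) != 0.
Proof. by rewrite (pcharf0P F).1 //; apply: u2_char0 Hv. Qed.

Lemma vM x y : x != 0 -> y != 0 -> v (x * y) = v x + v y.
Proof. exact: u2_mul Hv x y. Qed.

Lemma ord_eq1 : ord_eq 1 0.
Proof.
by split; rewrite ?oner_neq0 //; apply: (addrI (v 1)); rewrite addr0 -vM ?oner_neq0 // mulr1.
Qed.

Lemma ord_eq2 : ord_eq 2 1.
Proof. by split; [apply: natr_neq0|apply: u2_two Hv]. Qed.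

Lemma ord_eqM x y k l : ord_eq x k -> ord_eq y l -> ord_eq (x * y) (k + l).
Proof. by move=> [x0 <-] [y0 <-]; split; rewrite ?mulf_neq0 // vM. Qed.

Lemma vN x : v (- x) = v x.
Proof.
have [->|x0] := eqVneq x 0; first by rewrite oppr0.
have [_ v1] := ord_eq1; have n1 : (-1 : F) != 0 by rewrite oppr_eq0 oner_eq0.
by rewrite -mulN1r vM //; have := vM n1 n1; rewrite mulrNN mulr1 v1; lia.
Qed.

Lemma ord_eqN x k : ord_eq x k -> ord_eq (- x) k.
Proof. by move=> [x0 vx]; split; rewrite ?oppr_eq0 // vN. Qed.

Lemma ord_eqV x k : ord_eq x k -> ord_eq x^-1 (- k).
Proof.
move=> [x0 <-]; have x0' : x^-1 != 0 by rewrite invr_eq0.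
by split=> //; have [_ v1] := ord_eq1; have := vM x0 x0'; rewrite divff // v1; lia.
Qed.

Lemma ord_eqX x k n : ord_eq x k -> ord_eq (x ^+ n) (n%:Z * k).
Proof.
move=> hx; elim: n => [|n [x0 vx]]; first by rewrite mul0r; apply: ord_eq1.
by have [? ?] := ord_eqM hx (conj x0 vx); rewrite exprS; split=> //; lia.
Qed.

Lemma vX x n : x != 0 -> v (x ^+ n) = n%:Z * v x.
Proof. by move=> x0; have [_ ->] := ord_eqX n (conj x0 erefl). Qed.

Lemma ord_eq_pow2z (n : int) : ord_eq (2 ^ n) n.
Proof.
case: n => n; first by have := ord_eqX n ord_eq2; rewrite mulr1.
by have := ord_eqV (ord_eqX n.+1 ord_eq2); rewrite mulr1 NegzE -exprnN.
Qed.

Lemma ord_eq_pow2 n : ord_eq (2 ^+ n) n%:Z.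
Proof. exact: ord_eq_pow2z n. Qed.

Lemma ord_eq4 : ord_eq 4 2.
Proof. by have := ord_eq_pow2 2; rewrite -natrX. Qed.

Lemma dord_ge0 k : dord_ge 0 k.
Proof. by rewrite /dord_ge eqxx. Qed.

Lemma dord_geE x k : x != 0 -> dord_ge x k = (k <= 2 * v x).
Proof. by rewrite /dord_ge => /negPf ->. Qed.

Lemma ord_geE x k : ord_ge v x k <-> dord_ge x (2 * k).
Proof. by rewrite /dord_ge; split=> [[->|h]|/orP[/eqP|]]; [rewrite eqxx|lia|left|right; lia]. Qed.

Lemma in_oE x : in_o v x <-> dord_ge x 0.
Proof. exact: ord_geE. Qed.

Lemma dord_geW x k l : dord_ge x l -> k <= l -> dord_ge x k.
Proof. by move=> /orP[/eqP->|h] kl; [apply: dord_ge0|rewrite /dord_ge; lia]. Qed.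

Lemma dord_ge_v x : dord_ge x (2 * v x).
Proof. by rewrite /dord_ge lexx orbT. Qed.

Lemma ord_eq_dord_ge x k : ord_eq x k -> dord_ge x (2 * k).
Proof. by move=> [_ <-]; apply: dord_ge_v. Qed.

Lemma dord_ge_exact x (k : int) : dord_ge x (2 * k) -> ~~ dord_ge x (2 * k + 2) -> ord_eq x k.
Proof.
have [->|x0] := eqVneq x 0; first by rewrite !dord_ge0.
by rewrite !dord_geE // => h1 h2; split=> //; lia.
Qed.

Lemma dord_ge_round x (k : int) : dord_ge x (2 * k - 1) -> dord_ge x (2 * k).
Proof. by rewrite /dord_ge => /orP[->//|h]; apply/orP; right; lia. Qed.

Lemma dord_geN x k : dord_ge (- x) k = dord_ge x k.
Proof. by rewrite /dord_ge oppr_eq0 vN. Qed.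

Lemma dord_ge_signM n x k : dord_ge ((-1) ^+ n * x) k = dord_ge x k.
Proof. by rewrite -signr_odd; case: odd; rewrite ?mulN1r ?mul1r ?dord_geN. Qed.

Lemma dord_geD x y k : dord_ge x k -> dord_ge y k -> dord_ge (x + y) k.
Proof.
have [->|x0] := eqVneq x 0; first by rewrite add0r.
have [->|y0] := eqVneq y 0; first by rewrite addr0.
have [->|xy0] := eqVneq (x + y) 0; first by rewrite dord_ge0.
rewrite !dord_geE //; have := u2_add Hv x0 y0 xy0.
by rewrite ge_min; move: (v (x + y)) => z /orP[]; lia.
Qed.

Lemma dord_geB x y k : dord_ge x k -> dord_ge y k -> dord_ge (x - y) k.
Proof. by move=> hx hy; apply: dord_geD; rewrite ?dord_geN. Qed.

Lemma dord_geM x y (k l m : int) :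
  dord_ge x k -> dord_ge y l -> m <= k + l -> dord_ge (x * y) m.
Proof.
have [->|x0] := eqVneq x 0; first by rewrite mul0r !dord_ge0.
have [->|y0] := eqVneq y 0; first by rewrite mulr0 !dord_ge0.
by rewrite !dord_geE ?mulf_neq0 // vM //; lia.
Qed.

Lemma dord_ge_mul2 x (k m : int) : dord_ge x k -> m <= k + 2 -> dord_ge (2 * x) m.
Proof. by move=> hx hm; apply: dord_geM (ord_eq_dord_ge ord_eq2) hx _; lia. Qed.

Lemma dord_ge_div x y (k l m : int) :
  ord_eq y l -> dord_ge x k -> m <= k - 2 * l -> dord_ge (x / y) m.
Proof.
by move=> hy hx hm; apply: dord_geM hx (ord_eq_dord_ge (ord_eqV hy)) _; lia.
Qed.

Lemma dord_ge_sum (I : Type) (r : seq I) (P : pred I) (E : I -> F) k :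
  (forall i, P i -> dord_ge (E i) k) -> dord_ge (\sum_(i <- r | P i) E i) k.
Proof.
by move=> hE; elim/big_ind: _ => //; [apply: dord_ge0|move=> x y; apply: dord_geD].
Qed.

Lemma dord_ge_prod (I : Type) (r : seq I) (P : pred I) (E : I -> F) (k : I -> int) :
  (forall i, P i -> dord_ge (E i) (k i)) ->
  dord_ge (\prod_(i <- r | P i) E i) (\sum_(i <- r | P i) k i).
Proof.
move=> hE; elim/big_rec2: _ => [|i s y Pi hy]; first exact: ord_eq_dord_ge ord_eq1.
exact: dord_geM (hE i Pi) hy _.
Qed.

Lemma dord_geX x (k m : int) n : dord_ge x k -> m <= n%:Z * k -> dord_ge (x ^+ n) m.
Proof.
move=> hx; elim: n m => [|n IH] m hm.
  by apply: dord_geW (ord_eq_dord_ge ord_eq1) _; lia.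
by rewrite exprS; apply: dord_geM hx (IH _ (lexx _)) _; lia.
Qed.

Lemma ord_eqD x y (k : int) : ord_eq x k -> dord_ge y (2 * k + 1) -> ord_eq (x + y) k.
Proof.
move=> [x0 <-] hy.
have hxy : dord_ge (x + y) (2 * v x) by apply: dord_geD (dord_ge_v _) (dord_geW hy _); lia.
apply: dord_ge_exact hxy _; apply/negP => hxy.
have := dord_geB (dord_geW hxy _ : dord_ge _ (2 * v x + 1)) hy.
by rewrite addrK dord_geE //; lia.
Qed.

Lemma ord_eq_congr x y (k : int) : ord_eq x k -> dord_ge (x - y) (2 * k + 1) -> ord_eq y k.
Proof.
by move=> hx hxy; rewrite -[y](subKr x); apply: ord_eqD hx _; rewrite dord_geN.
Qed.

Lemma dord_ge_eq0 x : (forall n, dord_ge x (2 * n%:Z)) -> x = 0.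
Proof.
move=> hx; apply/eqP; apply: contraT => x0.
by have := hx `|v x|.+1; rewrite dord_geE //; lia.
Qed.

Lemma dord_ge_limit (u : nat -> F) :
  (forall n, dord_ge (u n.+1 - u n) (2 * n%:Z)) ->
  exists l, forall n, dord_ge (u n - l) (2 * n%:Z).
Proof.
move=> hu.
have cauchy p m : dord_ge (u (p + m)%N - u p) (2 * p%:Z).
  elim: m => [|m IH]; first by rewrite addn0 subrr dord_ge0.
  rewrite addnS -(subrKA (u (p + m)%N)); apply: dord_geD (dord_geW (hu _) _) IH; lia.
have [l hl] : exists l, forall N : int, exists M, forall p, (M <= p)%N -> ord_ge v (u p - l) N.
  apply: (u2_complete Hv) => N; exists `|N|%N => p q hp hq; apply/ord_geE.
  rewrite -(subrKA (u `|N|%N)) -[_ - u q]opprB.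
  apply: dord_geB; first by rewrite -(subnKC hp); apply: dord_geW (cauchy _ _) _; lia.
  by rewrite -(subnKC hq); apply: dord_geW (cauchy _ _) _; lia.
exists l => n; have [M /(_ (n + M)%N (leq_addl _ _)) /ord_geE hM] := hl n.
by have := dord_geB hM (cauchy n M); rewrite opprB addrC subrKA.
Qed.

Lemma dord_ge_sqrB_inj x y :
  dord_ge x 0 -> dord_ge y 0 -> dord_ge (x ^+ 2 - y ^+ 2) 2 -> dord_ge (x - y) 2.
Proof.
move=> hx hy hxy.
have : dord_ge ((x - y) ^+ 2) 2.
  have -> : (x - y) ^+ 2 = (x ^+ 2 - y ^+ 2) - 2 * (y * (x - y)) by ring.
  have h0 : dord_ge (y * (x - y)) 0 by apply: dord_geM hy (dord_geB hx hy) _.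
  by apply: dord_geB hxy (dord_ge_mul2 h0 _).
have [->|z0] := eqVneq (x - y) 0; first by rewrite dord_ge0.
by rewrite !dord_geE ?expf_neq0 // vX //; lia.
Qed.

Lemma residue_pigeonhole (w : nat -> F) :
  (forall n, dord_ge (w n) 0) -> exists n m, dord_ge (w n - w (n + m.+1)%N) 2.
Proof.
move=> hw; have [l [_ l_res]] := u2_res Hv.
pose close n y := dord_ge (w n - y) 2.
have has_close n : has (close n) l.
  have [y yl /ord_geE hy] := l_res _ ((in_oE _).2 (hw n)).
  by apply/hasP; exists y.
pose rep (i : 'I_(size l).+1) := Ordinal (etrans (esym (has_find (close i) l)) (has_close i)).
have /injectivePn[i [j ij rep_ij]] : ~~ injectiveb rep.
  by apply/injectiveP => /leq_card; rewrite !card_ord ltnn.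
have close_ij : dord_ge (w i - w j) 2.
  have := nth_find 0 (has_close i); have := nth_find 0 (has_close j).
  move/(congr1 val): rep_ij => /= <- hj hi.
  by have := dord_geB hi hj; rewrite opprB subrKA.
wlog lt_ij : i j ij close_ij {rep_ij} / (i < j)%N.
  move=> wl; have [|ji|/val_inj eij] := ltngtP i j; first exact: wl.
    by apply: (wl j i); rewrite 1?eq_sym // -dord_geN opprB.
  by rewrite eij eqxx in ij.
by exists i, (j - i.+1)%N; rewrite addnS -addSn subnKC.
Qed.

(* The sequence [t, t^2, t^4, ...] repeats modulo 2, and squaring is injective
   modulo 2, so [t] itself is congruent to a later, hence square, term. *)
Lemma residue_sqrt t : dord_ge t 0 -> exists2 s, dord_ge s 0 & dord_ge (t - s ^+ 2) 2.
Proof.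
move=> ht; pose w n := t ^+ (2 ^ n).
have wS n : w n.+1 = w n ^+ 2 by rewrite /w expnS mulnC exprM.
have hw n : dord_ge (w n) 0 by apply: dord_geX ht _.
have [n [m]] := residue_pigeonhole hw; elim: n => [|n IH] h.
  by exists (w m); rewrite // -wS.
by apply: IH; apply: dord_ge_sqrB_inj; rewrite -?wS -?addSn.
Qed.

(* [t |-> e - t^2] contracts the residue class of an approximate root. *)
Lemma artin_schreier_root (e t : F) :
  dord_ge e 0 -> dord_ge t 0 -> dord_ge (t ^+ 2 + t - e) 2 ->
  exists l, l ^+ 2 + l = e.
Proof.
move=> he ht hte; pose u n := iter n (fun x : F => e - x ^+ 2) t.
have h2t : dord_ge (2 * t) 2 by apply: dord_ge_mul2 ht _.
have u_contract n : dord_ge (u n - t) 2 /\ dord_ge (u n.+1 - u n) (2 * n.+1%:Z).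
  elim: n => [|n [u_n u_nS]].
    split; rewrite /= ?subrr ?dord_ge0 //.
    by have -> : e - t ^+ 2 - t = - (t ^+ 2 + t - e) by [ring]; rewrite dord_geN.
  have u_S : dord_ge (u n.+1 - t) 2.
    by rewrite -(subrKA (u n)); apply: dord_geD u_n; apply: dord_geW u_nS _; lia.
  split=> //.
  have -> : u n.+2 - u n.+1 =
     - ((u n.+1 - u n) * ((u n.+1 - t) + (u n - t) + 2 * t)) by rewrite /=; ring.
  by rewrite dord_geN; apply: dord_geM u_nS (dord_geD (dord_geD u_S u_n) h2t) _; lia.
have [n|l hl] := @dord_ge_limit u; first by apply: dord_geW (u_contract n).2 _; lia.
exists l; apply/eqP; rewrite -subr_eq0; apply/eqP; apply: dord_ge_eq0 => n.
have u0 : dord_ge (u n) 0.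
  by rewrite -[u n](subrK t); apply: dord_geD ht; apply: dord_geW (u_contract n).1 _.
have l0 : dord_ge l 0 by rewrite -[l](subKr t); apply: dord_geB ht (hl 0%N).
have -> : l ^+ 2 + l - e = - ((u n - l) * (u n + l + 1)) - (u n.+1 - u n) by rewrite /=; ring.
apply: dord_geB; last by apply: dord_geW (u_contract n).2 _; lia.
rewrite dord_geN; apply: dord_geM (hl n) (dord_geD (dord_geD u0 l0) _) _; last by rewrite addr0.
exact: ord_eq_dord_ge ord_eq1.
Qed.

Lemma v_artin_schreier (e t : F) :
  dord_ge e 0 -> (forall s, dord_ge s 0 -> ~~ dord_ge (s ^+ 2 + s - e) 2) ->
  t ^+ 2 + t - e != 0 /\ ~~ odd `|v (t ^+ 2 + t - e)|%N.
Proof.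
move=> he unsolvable; have [ht|] := boolP (dord_ge t 0).
  have h0 : dord_ge (t ^+ 2 + t - e) 0.
    by apply: dord_geB (dord_geD (dord_geX ht _) ht) he.
  by have [? ->] := dord_ge_exact (k := 0) h0 (unsolvable t ht).
have [->|t0] := eqVneq t 0; first by rewrite dord_ge0.
rewrite dord_geE // => vt.
have [] := @ord_eqD (t ^+ 2) (t - e) (2 * v t) (ord_eqX 2 (conj t0 erefl)).
  by apply: dord_geB (dord_geW (dord_ge_v t) _) (dord_geW he _); lia.
by rewrite addrA => ? ->; split=> //; lia.
Qed.

Lemma unram_quad_artin_schreier P e :
  P != 0 -> dord_ge e 0 -> (forall s, dord_ge s 0 -> ~~ dord_ge (s ^+ 2 + s - e) 2) ->
  unram_quad v (P ^+ 2 * (1 + 4 * e)).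
Proof.
move=> P0 he unsolvable; have [t0 _] := ord_eq2; have [f0 _] := ord_eq4.
have vAS t := v_artin_schreier t he unsolvable.
split=> [[y hy]|a b ab].
  have [/eqP[]] := vAS ((y / P - 1) / 2).
  have -> : ((y / P - 1) / 2) ^+ 2 + (y / P - 1) / 2 - e =
     (y ^+ 2 / P ^+ 2 - (1 + 4 * e)) / 4 by field; rewrite t0 P0 f0.
  by rewrite -hy mulrAC divff ?expf_neq0 // mul1r subrr mul0r.
have [b0|b0] := eqVneq b 0.
  case: ab => [a0|/eqP[]//].
  by rewrite b0 expr0n mulr0 subr0 vX //; lia.
pose t := (a / (P * b) - 1) / 2.
have -> : a ^+ 2 - P ^+ 2 * (1 + 4 * e) * b ^+ 2 = (2 * P * b) ^+ 2 * (t ^+ 2 + t - e).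
  by rewrite /t; field; rewrite t0 P0 b0.
have [n0 ev] := vAS t.
by rewrite vM ?expf_neq0 ?mulf_neq0 // vX ?mulf_neq0 //; lia.
Qed.

(* for [D != 0]: the extension [F(sqrt D)/F] is trivial or unramified quadratic *)
Definition sq_mod4 (D : F) : Prop := exists P, dord_ge (D - P ^+ 2) (2 * v D + 4).

Lemma sq_mod4_root D :
  D != 0 -> sq_mod4 D -> exists P, ord_eq D (2 * v P) /\ dord_ge (D - P ^+ 2) (2 * v D + 4).
Proof.
move=> D0 [P hP]; exists P; split=> //; split=> //.
have [] := ord_eq_congr (conj D0 erefl) (dord_geW hP _ : dord_ge (D - P ^+ 2) (2 * v D + 1)).
  by lia.
by rewrite expf_eq0 /= => P0; rewrite vX // => ->.
Qed.

Lemma sq_mod4_even D : D != 0 -> sq_mod4 D -> ~~ odd `|v D|%N.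
Proof. by move=> D0 /(sq_mod4_root D0) [P [[_ ->] _]]; lia. Qed.

Lemma sq_mod4_sqr P : sq_mod4 (P ^+ 2).
Proof. by exists P; rewrite subrr dord_ge0. Qed.

Lemma sq_mod4_congr D E :
  D != 0 -> sq_mod4 D -> dord_ge (D - E) (2 * v D + 4) -> sq_mod4 E.
Proof.
move=> D0 [P hP] hDE; exists P.
have [_ ->] : ord_eq E (v D) by apply: ord_eq_congr (conj D0 erefl) (dord_geW hDE _); lia.
by rewrite -[E](subKr D) addrAC; apply: dord_geB.
Qed.

Lemma sq_mod4M D E : D != 0 -> E != 0 -> sq_mod4 D -> sq_mod4 E -> sq_mod4 (D * E).
Proof.
move=> D0 E0 /(sq_mod4_root D0) [P [vD hP]] /(sq_mod4_root E0) [R [vE hR]].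
exists (P * R); rewrite vM //.
have -> : D * E - (P * R) ^+ 2 = D * (E - R ^+ 2) + R ^+ 2 * (D - P ^+ 2) by ring.
apply: dord_geD; first by apply: dord_geM (dord_ge_v D) hR _; lia.
by case: vE => _ vE; apply: dord_geM (dord_geX (dord_ge_v R) (lexx _)) hP _; lia.
Qed.

Lemma sq_mod4_mulsq D P : D != 0 -> P != 0 -> sq_mod4 (D * P ^+ 2) <-> sq_mod4 D.
Proof.
move=> D0 P0; split=> [h|h]; last exact: sq_mod4M (expf_neq0 _ P0) h (sq_mod4_sqr P).
have := sq_mod4M _ _ h (sq_mod4_sqr P^-1).
by rewrite exprVn mulfK ?expf_neq0 //; apply; rewrite ?mulf_neq0 ?invr_eq0 ?expf_neq0.
Qed.

Lemma sq_mod4_mulr D E : D != 0 -> E != 0 -> sq_mod4 E -> sq_mod4 (D * E) <-> sq_mod4 D.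
Proof.
move=> D0 E0 sE; split=> [sDE|sD]; last exact: sq_mod4M.
by have := sq_mod4M (mulf_neq0 D0 E0) E0 sDE sE; rewrite -mulrA -expr2 sq_mod4_mulsq.
Qed.

Lemma sq_mod4_sq_or_unram D : D != 0 -> sq_mod4 D -> is_sq D \/ unram_quad v D.
Proof.
move=> D0 /(sq_mod4_root D0) [P [[_ vD] hP]].
have P0 : P != 0.
  apply: contraNneq D0 => P0; move: hP; rewrite {}P0 expr0n subr0 /dord_ge.
  by case/orP => // ?; lia.
have [f0 _] := ord_eq4; pose e := (D - P ^+ 2) / (4 * P ^+ 2).
have -> : D = P ^+ 2 * (1 + 4 * e) by rewrite /e; field; rewrite P0 f0.
have he : dord_ge e 0.
  apply: dord_ge_div (ord_eqM ord_eq4 (ord_eqX 2 (conj P0 erefl))) hP _; lia.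
case: (classic (exists2 t, dord_ge t 0 & dord_ge (t ^+ 2 + t - e) 2)) => [[t ht hte]|unsolvable].
  have [l <-] := artin_schreier_root he ht hte.
  by left; exists (P * (1 + 2 * l)); ring.
right; apply: unram_quad_artin_schreier => // s hs.
by apply/negP => hse; apply: unsolvable; exists s.
Qed.

Lemma unram_quad_sq_mod4 D : D != 0 -> unram_quad v D -> sq_mod4 D.
Proof.
move=> D0 [_ norm_even].
have [h vD] : exists h, v D = 2 * h.
  have := norm_even 0 1 (or_intror (oner_neq0 _)).
  by rewrite expr0n expr1n mulr1 sub0r vN => ev; exists (v D %/ 2)%Z; lia.
have [q0 vq] := ord_eq_pow2z h; set q := 2 ^ h in q0 vq.
pose u := D / q ^+ 2; have Du : D = q ^+ 2 * u by rewrite /u mulrC divfK ?expf_neq0.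
have hu : dord_ge u 0.
  by apply: dord_ge_div (ord_eqX 2 (conj q0 vq)) (dord_ge_v D) _; lia.
have [s hs us] := residue_sqrt hu.
exists (q * s); rewrite Du exprMn -mulrBr -Du vD.
suff us4 : dord_ge (u - s ^+ 2) 4.
  by apply: dord_geM (dord_geX (dord_ge_v q) (lexx _)) us4 _; lia.
apply: contraT => us4; have [n0 vus] := @dord_ge_exact _ 1 us us4.
have := norm_even (q * s) 1 (or_intror (oner_neq0 _)); rewrite expr1n mulr1.
have -> : (q * s) ^+ 2 - D = - (q ^+ 2 * (u - s ^+ 2)) by rewrite {1}Du; ring.
by rewrite vN vM ?expf_neq0 // vus vX //; lia.
Qed.

Lemma xi0P D : D != 0 -> xi_val v D 0 <-> ~ sq_mod4 D.
Proof.
move=> D0; split=> [[[]//|[[]//|[_ [_ [nsq nun]]]]] sD|nsD].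
  by case: (sq_mod4_sq_or_unram D0 sD).
right; right; split=> //; split=> //; split; last by move/(unram_quad_sq_mod4 D0).
by move=> [y yD]; apply: nsD; rewrite yD; apply: sq_mod4_sqr.
Qed.

(** * Norms dominated by a quadratic form *)

Definition bform n (A : 'M[F]_n) (x y : 'cV[F]_n) : F := (x^T *m (A *m y)) 0 0.
Definition qform n (A : 'M[F]_n) (x : 'cV[F]_n) : F := bform A x x.

Lemma bformE n (A : 'M[F]_n) x y : bform A x y = \sum_i x i 0 * (A *m y) i 0.
Proof. by rewrite /bform mxE; apply: eq_bigr => i _; rewrite mxE. Qed.

Lemma bformC n (A : 'M[F]_n) x y : A^T = A -> bform A x y = bform A y x.
Proof.
move=> symA; rewrite /bform.
have -> : x^T *m (A *m y) = (y^T *m (A *m x))^T by rewrite !trmx_mul trmxK symA mulmxA.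
by rewrite mxE.
Qed.

Lemma bformZ n (A : 'M[F]_n) s t x y : bform A (s *: x) (t *: y) = s * t * bform A x y.
Proof. by rewrite /bform linearZ /= -!scalemxAr -scalemxAl scalerA mxE [t * s]mulrC. Qed.

Lemma bformDl n (A : 'M[F]_n) x y z : bform A (x + y) z = bform A x z + bform A y z.
Proof. by rewrite /bform linearD mulmxDl mxE. Qed.

Lemma bform_delta n (A : 'M[F]_n) i y : bform A (delta_mx i 0) y = (A *m y) i 0.
Proof. by rewrite /bform trmx_delta -rowE mxE. Qed.

Lemma mulmx_delta n (A : 'M[F]_n) i j : (A *m delta_mx j 0 : 'cV_n) i 0 = A i j.
Proof. by rewrite -colE mxE. Qed.

Lemma bform_congr n m (A : 'M[F]_n) (T : 'M_(n, m)) x y :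
  bform A (T *m x) (T *m y) = bform (T^T *m A *m T) x y.
Proof. by rewrite /bform trmx_mul !mulmxA. Qed.

Lemma congr_mxE n m (A : 'M[F]_n) (T : 'M_(n, m)) i j :
  (T^T *m A *m T) i j = bform A (col i T) (col j T).
Proof. by rewrite !colE bform_congr bform_delta mulmx_delta. Qed.

Lemma qformZ n (A : 'M[F]_n) s x : qform A (s *: x) = s ^+ 2 * qform A x.
Proof. exact: bformZ. Qed.

Lemma qformD n (A : 'M[F]_n) x y :
  A^T = A -> qform A (x + y) = qform A x + qform A y + 2 * bform A x y.
Proof.
move=> symA; rewrite /qform bformDl ![bform A _ (x + y)]bformC // !bformDl.
rewrite [bform A y x]bformC //; ring.
Qed.

Lemma col_sum_delta n (x : 'cV[F]_n) : x = \sum_i x i 0 *: delta_mx i 0.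
Proof. by rewrite [LHS]matrix_sum_delta; apply: eq_bigr => i _; rewrite big_ord1. Qed.

(* [x] lies in the ball of radius [k/2] of the norm with weights [a] *)
Definition level n (a : 'I_n -> int) (k : int) (x : 'cV[F]_n) : Prop :=
  forall i, dord_ge (x i 0) (k - a i).

Lemma levelD n (a : 'I_n -> int) k x y : level a k x -> level a k y -> level a k (x + y).
Proof. by move=> hx hy i; rewrite mxE; apply: dord_geD. Qed.

Lemma levelZ n (a : 'I_n -> int) (k l m : int) s x :
  dord_ge s l -> level a k x -> m <= l + k -> level a m (s *: x).
Proof. by move=> hs hx hm i; rewrite mxE; apply: dord_geM hs (hx i) _; lia. Qed.

Lemma level_delta n (a : 'I_n -> int) i : level a (a i) (delta_mx i 0).
Proof.
move=> j; rewrite mxE andbT; have [->|_] := eqVneq; last exact: dord_ge0.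
by apply: dord_geW (ord_eq_dord_ge ord_eq1) _; lia.
Qed.

(* [A] is dominated by the norm with weights [a], the off-diagonal entries with
   an excess of [h/2]; [2B] satisfies this with [h = 0] when [a] is in [S(B)] *)
Definition dominated (h : int) n (A : 'M[F]_n) (a : 'I_n -> int) : Prop :=
  [/\ A^T = A, forall i, dord_ge (A i i) (2 * a i + 2) &
      forall i j, i != j -> dord_ge (A i j) (a i + a j + h)].

Section Dominated.
Variables (h : int) (n : nat) (A : 'M[F]_n) (a : 'I_n -> int).
Hypothesis A_dom : dominated h A a.

Lemma dominated_sym i j : A i j = A j i.
Proof. by have [symA _ _] := A_dom; rewrite -[in LHS]symA mxE. Qed.

Lemma dominated_entry i j : h <= 2 -> dord_ge (A i j) (a i + a j + h).
Proof.
have [_ diag offdiag] := A_dom; have [->|ij] := eqVneq i j => h_le2; last exact: offdiag.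
by apply: dord_geW (diag j) _; lia.
Qed.

Lemma dominated_mulmx (k : int) y j :
  h <= 2 -> level a k y -> dord_ge ((A *m y) j 0) (k + a j + h).
Proof.
move=> h_le2 hy; rewrite mxE; apply: dord_ge_sum => i _.
by apply: dord_geM (dominated_entry j i h_le2) (hy i) _; lia.
Qed.

Lemma dominated_bform (k l : int) x y :
  h <= 2 -> level a k x -> level a l y -> dord_ge (bform A x y) (k + l + h).
Proof.
move=> h_le2 hx hy; rewrite bformE; apply: dord_ge_sum => i _.
by apply: dord_geM (hx i) (dominated_mulmx i h_le2 hy) _; lia.
Qed.

Lemma dominated_qform (k : int) x :
  0 <= h <= 2 -> level a k x -> dord_ge (qform A x) (2 * k + 2).
Proof.
move=> /andP[h_ge0 h_le2] hx; have [symA diag _] := A_dom.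
suff [] : level a k x /\ dord_ge (qform A x) (2 * k + 2) by [].
rewrite [x in level a k x /\ _]col_sum_delta [x in qform A x]col_sum_delta.
elim/big_ind: _ => [|y z [hy qy] [hz qz]|i _].
- by split=> [i|]; rewrite ?mxE ?dord_ge0 // /qform /bform trmx0 mul0mx mxE dord_ge0.
- split; first exact: levelD.
  rewrite qformD //; apply: dord_geD (dord_geD qy qz) _.
  by apply: dord_ge_mul2 (dominated_bform h_le2 hy hz) _; lia.
- split; first by apply: levelZ (hx i) (level_delta a i) _; lia.
  rewrite qformZ /qform bform_delta mulmx_delta.
  by apply: dord_geM (dord_geX (hx i) (lexx _)) (diag i) _; lia.
Qed.

End Dominated.

Lemma dominatedW h n (A : 'M[F]_n) a b :
  (forall i, b i <= a i) -> dominated h A a -> dominated h A b.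
Proof.
move=> ba [symA diag offdiag]; split=> // [i|i j ij].
  by apply: dord_geW (diag i) _; have := ba i; lia.
by apply: dord_geW (offdiag i j ij) _; have := ba i; have := ba j; lia.
Qed.

Lemma dominatedS h n (A : 'M[F]_n) a : dominated h A a ->
  (exists i j, i != j /\ A i j != 0 /\ 2 * v (A i j) = a i + a j + h) \/ dominated (h + 1) A a.
Proof.
move=> [symA diag offdiag]; apply: NNPP => /not_or_and[no_pivot]; apply.
split=> // i j ij; have [->|A0] := eqVneq (A i j) 0; first exact: dord_ge0.
have := offdiag i j ij; rewrite !dord_geE // => hij.
have [e|] := eqVneq (2 * v (A i j)) (a i + a j + h); last by lia.
by case: no_pivot; exists i, j.
Qed.

Definition weighted_isometry n (T : 'M[F]_n) (a' a : 'I_n -> int) : Prop :=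
  [/\ \det T ^+ 2 = 1, forall i j, dord_ge (T i j) (a' j - a i) &
      exists2 T', T *m T' = 1%:M & forall i j, dord_ge (T' i j) (a j - a' i)].

Lemma dominated_congr h n (A T : 'M[F]_n) a' a :
  0 <= h <= 2 -> weighted_isometry T a' a -> dominated h A a ->
  dominated h (T^T *m A *m T) a'.
Proof.
move=> h_range [_ hT _] A_dom; have [symA _ _] := A_dom; have /andP[_ h_le2] := h_range.
have lev i : level a (a' i) (col i T) by move=> j; rewrite mxE; apply: hT.
split=> [|i|i j ij]; first by rewrite !trmx_mul trmxK symA mulmxA.
- by rewrite congr_mxE; apply: dominated_qform A_dom _ _ h_range (lev i).
- by rewrite congr_mxE; apply: dominated_bform A_dom _ _ _ _ h_le2 (lev i) (lev j).
Qed.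

Lemma dord_ge_det n (A : 'M[F]_n) (a b : 'I_n -> int) :
  (forall i j, dord_ge (A i j) (a i + b j)) -> dord_ge (\det A) (\sum_i a i + \sum_i b i).
Proof.
move=> hA; apply: dord_ge_sum => s _.
rewrite dord_ge_signM [\sum_i b i](reindex_perm s) -big_split /=.
by apply: dord_ge_prod => i _.
Qed.

Lemma weighted_isometry_sum n (T : 'M[F]_n) a' a :
  weighted_isometry T a' a -> \sum_i a' i = \sum_i a i.
Proof.
have sum_le (U : 'M[F]_n) (b b' : 'I_n -> int) : \det U ^+ 2 = 1 ->
    (forall i j, dord_ge (U i j) (b' j - b i)) -> \sum_i b' i <= \sum_i b i.
  move=> dU hU; have U0 : \det U != 0.
    by apply/eqP => U0; move: dU; rewrite U0 expr0n => /esym/eqP; rewrite oner_eq0.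
  have vU : v (\det U) = 0.
    by have [_ v1] := ord_eq1; have := vX 2 U0; rewrite dU v1; lia.
  have : dord_ge (\det U) (\sum_i - b i + \sum_i b' i).
    by apply: dord_ge_det => i j; rewrite addrC.
  by rewrite dord_geE // sumrN vU mulr0 addrC subr_le0.
move=> [dT hT [T' TT' hT']]; apply/eqP; rewrite eq_le (sum_le T) // (sum_le T') //.
have := congr1 determinant TT'; rewrite det_mulmx det1 => dTT'.
by rewrite -[LHS]mul1r -dT -exprMn dTT' expr1n.
Qed.

(* [c] is a vector of level [k] on which the quadratic form takes exactly the value
   given by the norm, and which is orthogonal to the basis up to an excess of [h/2] *)
Definition sharp_vec n (A : 'M[F]_n) (a : 'I_n -> int) (k h : int) (c : 'cV[F]_n) : Prop :=
  [/\ level a k c, ord_eq (qform A c) (k + 1) &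
      forall j, dord_ge ((A *m c) j 0) (k + a j + h)].

Definition sharp_pair n (A : 'M[F]_n) (a : 'I_n -> int) (h : int) : Prop :=
  exists k c k' c', [/\ odd `|(k + k')%R|%N, sharp_vec A a k h c & sharp_vec A a k' h c'].

Lemma sharp_vec_congr n (A T : 'M[F]_n) a' a k h c :
  weighted_isometry T a' a -> sharp_vec (T^T *m A *m T) a' k h c -> sharp_vec A a k h (T *m c).
Proof.
move=> [_ hT [T' TT' hT']] [lev_c qc orth_c]; split=> [i||j].
- rewrite mxE; apply: dord_ge_sum => j _.
  by apply: dord_geM (hT i j) (lev_c j) _; lia.
- by rewrite /qform bform_congr.
- have -> : A *m (T *m c) = T'^T *m (T^T *m A *m T *m c).
    by rewrite !mulmxA -trmx_mul TT' trmx1 mul1mx.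
  rewrite mxE; apply: dord_ge_sum => i _; rewrite mxE.
  by apply: dord_geM (hT' i j) (orth_c i) _; lia.
Qed.

Lemma sharp_pair_congr n (A T : 'M[F]_n) a' a h :
  weighted_isometry T a' a -> sharp_pair (T^T *m A *m T) a' h -> sharp_pair A a h.
Proof.
move=> T_iso [k [c [k' [c' [odd_kk' sharp_c sharp_c']]]]].
by exists k, (T *m c), k', (T *m c'); split=> //; apply: sharp_vec_congr T_iso _.
Qed.

Lemma sharp_vec_block d e (X : 'M[F]_d) (Y : 'M_e) a k h c :
  sharp_vec Y (a \o @rshift d e) k h c -> sharp_vec (block_mx X 0 0 Y) a k h (col_mx 0 c).
Proof.
move=> [lev_c qc orth_c].
have Ac : block_mx X 0 0 Y *m col_mx 0 c = col_mx 0 (Y *m c).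
  by rewrite mul_block_col !mulmx0 !mul0mx addr0 add0r.
split=> [j||j].
- case: (split_ordP j) => l ->; first by rewrite col_mxEu mxE dord_ge0.
  by rewrite col_mxEd; apply: lev_c.
- by rewrite /qform /bform Ac tr_col_mx mul_row_col mulmx0 add0r.
- rewrite Ac; case: (split_ordP j) => l ->; first by rewrite col_mxEu mxE dord_ge0.
  by rewrite col_mxEd; apply: orth_c.
Qed.

Lemma sharp_pair_block d e (X : 'M[F]_d) (Y : 'M_e) a h :
  sharp_pair Y (a \o @rshift d e) h -> sharp_pair (block_mx X 0 0 Y) a h.
Proof.
move=> [k [c [k' [c' [odd_kk' sharp_c sharp_c']]]]].
by exists k, (col_mx 0 c), k', (col_mx 0 c'); split=> //; apply: sharp_vec_block.
Qed.

Lemma sharp_vec_delta h n (A : 'M[F]_n) a i :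
  h <= 2 -> dominated h A a -> ord_eq (A i i) (a i + 1) -> sharp_vec A a (a i) h (delta_mx i 0).
Proof.
move=> h_le2 A_dom Aii; split=> [||j]; first exact: level_delta.
  by rewrite /qform bform_delta mulmx_delta.
by apply: dominated_mulmx A_dom _ _ _ h_le2 (level_delta a i).
Qed.

Definition disc n (A : 'M[F]_n) : F := (-1) ^+ n./2 * \det A.

Lemma disc_congr n (A T : 'M[F]_n) : disc (T^T *m A *m T) = disc A * \det T ^+ 2.
Proof. by rewrite /disc !det_mulmx det_tr; ring. Qed.

Lemma disc_block d e (X : 'M[F]_d) (Y : 'M_e) :
  ~~ (odd d && odd e) -> disc (block_mx X 0 0 Y) = disc X * disc Y.
Proof.
move=> de; rewrite /disc det_ublock; have -> : ((d + e)./2 = d./2 + e./2)%N by lia.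
by rewrite exprD; ring.
Qed.

Lemma disc_mx0 (A : 'M[F]_0) : disc A = 1.
Proof. by rewrite /disc det_mx00 mulr1. Qed.

Lemma disc_mx1 (A : 'M[F]_1) : disc A = A 0 0.
Proof. by rewrite /disc det_mx11 mul1r. Qed.

Lemma sumz_const n (c : int) : \sum_(i < n) c = c * n%:Z.
Proof. by rewrite sumr_const card_ord -mulr_natr natz. Qed.

Lemma dominated_disc (h : int) n (A : 'M[F]_n) a :
  h <= 2 -> dominated h A a -> dord_ge (disc A) (2 * (\sum_i a i) + h * n%:Z).
Proof.
move=> h_le2 A_dom; rewrite /disc dord_ge_signM.
have /dord_ge_det : forall i j, dord_ge (A i j) (a i + (a j + h)).
  by move=> i j; rewrite addrA; apply: dominated_entry.
rewrite big_split /= sumz_const; move: (\sum_i a i) => S hdet.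
by apply: dord_geW hdet _; lia.
Qed.

Lemma disc_mx2 (A : 'M[F]_2) : A^T = A -> disc A = A 0 1 ^+ 2 - A 0 0 * A 1 1.
Proof.
move=> symA; have A10 : A 1 0 = A 0 1 by rewrite -{1}symA mxE.
rewrite /disc (expand_det_row _ 0) !big_ord_recl big_ord0 /cofactor !det_mx11 !mxE /=.
have -> : lift (0 : 'I_2) 0 = 1 by apply: val_inj.
have -> : lift (1 : 'I_2) 0 = 0 by apply: val_inj.
by rewrite A10 expr0 expr1; ring.
Qed.

(* What the norm with weights [a] tells about the class of [disc A] modulo squares;
   equality in the resulting bound [|a| <= Delta] provides sharp vectors. *)
Definition disc_estimate n (A : 'M[F]_n) (a : 'I_n -> int) : Prop :=
  let S := \sum_i a i in let D := disc A in
  if odd n then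
    dord_ge D (2 * S + 2) /\
    (ord_eq D (S + 1) -> exists k c P,
      sharp_vec A a k 2 c /\ dord_ge (D - qform A c * P ^+ 2) (2 * v D + 4))
  else
    [/\ exists2 P, dord_ge P S & dord_ge (D - P ^+ 2) (2 * S + 4),
        ord_eq D (S + 1) -> ~ sq_mod4 D -> sharp_pair A a 1 &
        ord_eq D (S + 2) -> odd `|S|%N -> sharp_pair A a 2].

Lemma disc_estimate_congr n (A T : 'M[F]_n) a' a :
  weighted_isometry T a' a -> disc_estimate (T^T *m A *m T) a' -> disc_estimate A a.
Proof.
move=> T_iso; have [dT _ _] := T_iso.
rewrite /disc_estimate (weighted_isometry_sum T_iso) disc_congr dT mulr1.
case: (odd n) => [[bound sharp]|[bound sharp1 sharp2]].
  split=> // /sharp[k [c [P [sharp_c hP]]]]; exists k, (T *m c), P.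
  by rewrite /qform bform_congr; split=> //; apply: sharp_vec_congr T_iso _.
by split=> // => [hD nsq|hD odd_S]; apply: sharp_pair_congr T_iso _; [apply: sharp1|apply: sharp2].
Qed.

(** * Splitting off planes *)

Lemma perm_weighted_isometry n (s : 'S_n) a : weighted_isometry (perm_mx s^-1) (a \o s) a.
Proof.
split=> [|i j|]; first by rewrite det_perm sqrr_sign.
  rewrite !mxE /=; case: eqP => [<-|_]; last exact: dord_ge0.
  by rewrite permKV subrr; apply: ord_eq_dord_ge ord_eq1.
exists (perm_mx s) => [|i j]; first by rewrite -perm_mxM mulVg perm_mx1.
rewrite !mxE /=; case: eqP => [<-|_]; last exact: dord_ge0.
by rewrite subrr; apply: ord_eq_dord_ge ord_eq1.
Qed.

Lemma congr_perm n (A : 'M[F]_n) (s : 'S_n) :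
  (perm_mx s^-1)^T *m A *m perm_mx s^-1 = \matrix_(i, j) A (s i) (s j).
Proof. by rewrite tr_perm_mx invgK -row_permE -col_permE; apply/matrixP => i j; rewrite !mxE. Qed.

Lemma perm_two_points n (i0 i1 i j : 'I_n) :
  i0 != i1 -> i != j -> exists s : 'S_n, s i0 = i /\ s i1 = j.
Proof.
move=> i01 ij; pose j' := tperm i0 i j.
have j'0 : j' != i0.
  by rewrite -(inj_eq (@perm_inj _ (tperm i0 i))) /j' tpermK tpermL eq_sym.
exists (tperm i1 j' * tperm i0 i)%g; rewrite !permM tpermL tpermK.
by rewrite (tpermD _ j'0) 1?eq_sym // tpermL.
Qed.

Definition sharp_plane (h : int) (X : 'M[F]_2) (a : 'I_2 -> int) : Prop :=
  dominated h X a /\ exists2 r, ord_eq (X 0 1) r & 2 * r = a 0 + a 1 + h.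

Lemma ord2P (i : 'I_2) : i = 0 \/ i = 1.
Proof. by case: i => [[|[|//]] ?]; [left|right]; apply: val_inj. Qed.

Lemma sum_ord2 (V : nmodType) (f : 'I_2 -> V) : \sum_i f i = f 0 + f 1.
Proof. by rewrite big_ord_recl big_ord1; congr (_ + f _); apply: val_inj. Qed.

Lemma sharp_plane_disc_congr h (X : 'M[F]_2) a :
  sharp_plane h X a -> dord_ge (disc X - X 0 1 ^+ 2) (2 * (a 0 + a 1) + 4).
Proof.
move=> [[symX diag _] _]; rewrite disc_mx2 // addrAC subrr add0r dord_geN.
by apply: dord_geM (diag 0) (diag 1) _; lia.
Qed.

Section SharpPlane.
Variables (h : int) (X : 'M[F]_2) (a : 'I_2 -> int).
Hypotheses (h_le1 : h <= 1) (X_sharp : sharp_plane h X a).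

Lemma sharp_plane_disc : ord_eq (disc X) (a 0 + a 1 + h).
Proof.
have [_ [r hr vr]] := X_sharp; rewrite -vr.
rewrite -[disc X](subrK (X 0 1 ^+ 2)) addrC; apply: ord_eqD (ord_eqX 2 hr) _.
by apply: dord_geW (sharp_plane_disc_congr X_sharp) _; lia.
Qed.

Lemma sharp_plane_solve m (Y : 'M_(2, m)) (b : 'I_m -> int) :
  (forall i k, dord_ge (Y i k) (a i + b k + h)) ->
  exists2 w, X *m w = Y & forall i k, dord_ge (w i k) (b k - a i).
Proof.
move=> hY; have [X_dom _] := X_sharp.
have hX i j : dord_ge (X i j) (a i + a j + h) by apply: dominated_entry X_dom _ _ _; lia.
have X10 := dominated_sym X_dom 1 0; have [symX _ _] := X_dom; have discX := disc_mx2 symX.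
have disc_ord := sharp_plane_disc; have [disc0 _] := disc_ord.
pose w := \matrix_(i < 2, k < m)
  ((X 0 1 * Y (1 - i) k - X (1 - i) (1 - i) * Y i k) / disc X).
exists w => [|i k].
  apply/matrixP => i k; rewrite mxE sum_ord2 !mxE subr0 subrr.
  case: (ord2P i) => ->; rewrite ?X10; move: disc0; rewrite discX => disc0;
    by field.
have sum_a : a i + a (1 - i) = a 0 + a 1.
  by case: (ord2P i) => ->; rewrite ?subr0 // subrr addrC.
have num : dord_ge (X 0 1 * Y (1 - i) k - X (1 - i) (1 - i) * Y i k)
    (b k + a (1 - i) + a 0 + a 1 + 2 * h).
  apply: dord_geB; first by apply: dord_geM (hX 0 1) (hY (1 - i) k) _; lia.
  by apply: dord_geM (hX (1 - i) (1 - i)) (hY i k) _; lia.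
by rewrite mxE; apply: dord_ge_div disc_ord num _; lia.
Qed.

End SharpPlane.

Lemma dominated_mxsub h m n (f : 'I_m -> 'I_n) (A : 'M[F]_n) a :
  injective f -> dominated h A a -> dominated h (mxsub f f A) (a \o f).
Proof.
move=> f_inj [symA diag offdiag]; split=> [|i|i j ij]; rewrite ?mxE //.
  by rewrite -[in RHS]symA; apply/matrixP => i j; rewrite !mxE.
by apply: offdiag; rewrite (inj_eq f_inj).
Qed.

Lemma dominated_ulsubmx h p q (A : 'M[F]_(p + q)) a :
  dominated h A a -> dominated h (ulsubmx A) (a \o @lshift p q).
Proof.
move/(dominated_mxsub (@lshift_inj p q)); congr dominated.
by apply/matrixP => i j; rewrite !mxE.
Qed.

Lemma dominated_drsubmx h p q (A : 'M[F]_(p + q)) a :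
  dominated h A a -> dominated h (drsubmx A) (a \o @rshift p q).
Proof.
move/(dominated_mxsub (@rshift_inj p q)); congr dominated.
by apply/matrixP => i j; rewrite !mxE.
Qed.

Lemma dord_ge_mx1 n (a : 'I_n -> int) i j : dord_ge ((1%:M : 'M_n) i j) (a j - a i).
Proof.
rewrite mxE; case: eqP => [->|_]; last exact: dord_ge0.
by rewrite subrr; apply: ord_eq_dord_ge ord_eq1.
Qed.

Lemma unipotent_weighted_isometry p q (w : 'M_(p, q)) (a : 'I_(p + q) -> int) :
  (forall i k, dord_ge (w i k) (a (rshift p k) - a (lshift q i))) ->
  weighted_isometry (block_mx 1%:M w 0 1%:M) a a.
Proof.
move=> hw.
have entry_ge (w' : 'M_(p, q)) i j :
    (forall i k, dord_ge (w' i k) (a (rshift p k) - a (lshift q i))) ->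
    dord_ge (block_mx 1%:M w' 0 1%:M i j) (a j - a i).
  move=> hw'; case: (split_ordP i) => i' ->; case: (split_ordP j) => j' ->.
  - by rewrite block_mxEul; apply: (dord_ge_mx1 (a \o @lshift p q)).
  - by rewrite block_mxEur.
  - by rewrite block_mxEdl mxE dord_ge0.
  - by rewrite block_mxEdr; apply: (dord_ge_mx1 (a \o @rshift p q)).
split=> [|i j|]; [by rewrite det_ublock !det1 mulr1 expr1n|exact: entry_ge|].
exists (block_mx 1%:M (- w) 0 1%:M) => [|i j].
  by rewrite mulmx_block !(mul0mx, mulmx0, mul1mx, mulmx1, addr0, add0r) addNr -scalar_mx_block.
by apply: entry_ge => i' k; rewrite mxE dord_geN.
Qed.

Lemma sharp_plane_splits (h : int) m (A : 'M[F]_(2 + m)) a :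
  h <= 1 -> dominated h A a -> sharp_plane h (ulsubmx A) (a \o @lshift 2 m) ->
  exists T Y, weighted_isometry T a a /\ T^T *m A *m T = block_mx (ulsubmx A) 0 0 Y.
Proof.
move=> h_le1 A_dom A_sharp; have [symA _ _] := A_dom.
have hY i k : dord_ge (ursubmx A i k) ((a \o @lshift 2 m) i + (a \o @rshift 2 m) k + h).
  by rewrite !mxE; apply: dominated_entry A_dom _ _ _; lia.
have [w Xw hw] := sharp_plane_solve h_le1 A_sharp hY.
have tX : (ulsubmx A)^T = ulsubmx A by rewrite trmx_ulsub symA.
have tY : dlsubmx A = (ursubmx A)^T by rewrite trmx_ursub symA.
exists (block_mx 1%:M (- w) 0 1%:M), (drsubmx A - dlsubmx A *m w); split; last first.
  rewrite tr_block_mx !trmx1 trmx0 linearN /= -[in LHS](submxK A) !mulmx_block.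
  rewrite !(mul0mx, mulmx0, mul1mx, mulmx1, addr0) tY -Xw trmx_mul tX.
  by rewrite !mulmxN !mulNmx -!mulmxA !(addNr, mulNmx, mul0mx, mulmx0, oppr0, add0r) addrC.
by apply: unipotent_weighted_isometry => i k; rewrite mxE dord_geN; apply: hw.
Qed.

Lemma plane_ind (h : int) (P : forall n, 'M[F]_n -> ('I_n -> int) -> Prop) :
  0 <= h -> h <= 1 ->
  (forall n A T a' a, weighted_isometry T a' a -> P n (T^T *m A *m T) a' -> P n A a) ->
  (forall n A a, dominated (h + 1) A a -> P n A a) ->
  (forall m X Y a, sharp_plane h X (a \o @lshift 2 m) ->
     dominated h (block_mx X 0 0 Y) a -> P m Y (a \o @rshift 2 m) ->
     P (2 + m)%N (block_mx X 0 0 Y) a) ->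
  forall n A a, dominated h A a -> P n A a.
Proof.
move=> h_ge0 h_le1 P_congr P_base P_plane; have h_range : 0 <= h <= 2 by lia.
elim/ltn_ind => n IH A a A_dom.
have [[i [j [ij [Aij0 vAij]]]]|/P_base//] := dominatedS A_dom.
case: n A a IH A_dom i j ij Aij0 vAij => [|[|m]] A a IH A_dom i j ij Aij0 vAij.
- by case: i ij Aij0 vAij.
- by rewrite !ord1 eqxx in ij.
have [//|s [si sj]] := @perm_two_points _ (@lshift 2 m 0) (@lshift 2 m 1) i j _ ij.
apply: (P_congr _ _ _ _ _ (perm_weighted_isometry s a)).
have := dominated_congr h_range (perm_weighted_isometry s a) A_dom.
rewrite congr_perm; set A' : 'M_(2 + m) := \matrix_(_, _) _; set a' : 'I_(2 + m) -> int := _ \o _.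
move=> A'_dom.
have A'_sharp : sharp_plane h (ulsubmx A') (a' \o @lshift 2 m).
  split; first exact: dominated_ulsubmx A'_dom.
  by exists (v (A i j)); [rewrite !mxE si sj|rewrite /a' /= si sj].
have [T [Y [T_iso A'T]]] := sharp_plane_splits h_le1 A'_dom A'_sharp.
apply: (P_congr _ _ _ _ _ T_iso).
have := dominated_congr h_range T_iso A'_dom; rewrite A'T => XY_dom.
apply: P_plane => //; apply: IH => //.
by have := dominated_drsubmx XY_dom; rewrite block_mxKdr.
Qed.

(** * The bound on the weights *)

Lemma ord_eq_exclude D (k l : int) : dord_ge D l -> 2 * k < l -> ~ ord_eq D k.
Proof. by move=> hD kl [D0 vD]; move: hD; rewrite dord_geE // vD; lia. Qed.

Lemma sharp_pair_plane (h : int) (A : 'M[F]_2) a :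
  h <= 2 -> dominated h A a -> odd `|(a 0 + a 1)%R|%N ->
  ~~ dord_ge (A 0 0 * A 1 1) (2 * (a 0 + a 1) + 6) -> sharp_pair A a h.
Proof.
move=> h_le2 A_dom odd_a prod_small; have [_ diag _] := A_dom.
exists (a 0), (delta_mx 0 0), (a 1), (delta_mx 1 0); split=> //.
  apply: sharp_vec_delta h_le2 A_dom (dord_ge_exact _ _); first by apply: dord_geW (diag 0) _; lia.
  by apply: contra prod_small => A00; apply: dord_geM A00 (diag 1) _; lia.
apply: sharp_vec_delta h_le2 A_dom (dord_ge_exact _ _); first by apply: dord_geW (diag 1) _; lia.
by apply: contra prod_small => A11; apply: dord_geM (diag 0) A11 _; lia.
Qed.

Lemma disc_estimate_of_large n (A : 'M[F]_n) a :
  dord_ge (disc A) (2 * (\sum_i a i) + 6) -> disc_estimate A a.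
Proof.
rewrite /disc_estimate; set S := \sum_i a i => hD; case: (odd n).
  by split=> [|/ord_eq_exclude-/(_ _ hD)[]]; [apply: dord_geW hD _|]; lia.
split.
- by exists 0; rewrite ?dord_ge0 // expr0n subr0; apply: dord_geW hD _; lia.
- by move=> /ord_eq_exclude-/(_ _ hD)[]; lia.
- by move=> /ord_eq_exclude-/(_ _ hD)[]; lia.
Qed.

Lemma disc_estimate_mx0 (A : 'M[F]_0) a : disc_estimate A a.
Proof.
rewrite /disc_estimate /= disc_mx0 big_ord0; split=> [|[_ v1]|[_ v1]]; last 2 first.
- by have [_ w1] := ord_eq1; rewrite w1 in v1.
- by have [_ w1] := ord_eq1; rewrite w1 in v1.
by exists 1; rewrite ?expr1n ?subrr ?dord_ge0 //; apply: ord_eq_dord_ge ord_eq1.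
Qed.

Lemma disc_estimate_mx1 (A : 'M[F]_1) a : dominated 2 A a -> disc_estimate A a.
Proof.
move=> A_dom; have [_ diag _] := A_dom.
rewrite /disc_estimate /= disc_mx1 big_ord1; split=> [|A00]; first exact: diag.
exists (a 0), (delta_mx 0 0), 1; split; first exact: sharp_vec_delta A_dom A00.
by rewrite /qform bform_delta mulmx_delta expr1n mulr1 subrr dord_ge0.
Qed.

Lemma disc_estimate_mx2 (A : 'M[F]_2) a : dominated 2 A a -> disc_estimate A a.
Proof.
move=> A_dom; have [symA _ _] := A_dom; have := dominated_disc (lexx 2) A_dom.
rewrite /disc_estimate /= sum_ord2 => hD; split.
- by exists 0; rewrite ?dord_ge0 // expr0n subr0.
- by move=> /ord_eq_exclude-/(_ _ hD)[]; lia.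
move=> discA odd_a; apply: (sharp_pair_plane (lexx 2) A_dom odd_a).
apply/negP => hA; have [] : ord_eq (A 0 1 ^+ 2) (a 0 + a 1 + 2).
  apply: ord_eq_congr discA _; rewrite disc_mx2 // addrAC subrr add0r dord_geN.
  by apply: dord_geW hA _; lia.
by rewrite expf_eq0 /= => A01; rewrite vX //; lia.
Qed.

Lemma disc_estimate_dominated2 n (A : 'M[F]_n) a : dominated 2 A a -> disc_estimate A a.
Proof.
case: n A a => [|[|[|n]]] A a A_dom.
- exact: disc_estimate_mx0.
- exact: disc_estimate_mx1.
- exact: disc_estimate_mx2.
apply: disc_estimate_of_large; apply: dord_geW (dominated_disc (lexx 2) A_dom) _.
by rewrite lerD2l; lia.
Qed.

Definition disc_estimate_half n (A : 'M[F]_n) (a : 'I_n -> int) : Prop :=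
  disc_estimate A a /\ ((0 < n)%N -> dord_ge (disc A) (2 * (\sum_i a i) + 2)).

Lemma disc_estimate_half_congr n (A T : 'M[F]_n) a' a :
  weighted_isometry T a' a -> disc_estimate_half (T^T *m A *m T) a' -> disc_estimate_half A a.
Proof.
move=> T_iso [est half]; split; first exact: disc_estimate_congr T_iso est.
have [dT _ _] := T_iso.
by move: half; rewrite disc_congr dT mulr1 (weighted_isometry_sum T_iso).
Qed.

Lemma disc_estimate_half_plane (X : 'M[F]_2) a : sharp_plane 1 X a -> disc_estimate_half X a.
Proof.
move=> X_sharp; have discX := sharp_plane_disc (lexx 1) X_sharp.
have [X_dom [r X01 vr]] := X_sharp; have [_ vdisc] := discX; have [symX _ _] := X_dom.
rewrite /disc_estimate_half /disc_estimate /= sum_ord2; split; last first.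
  by move=> _; apply: dord_geW (ord_eq_dord_ge discX) _; lia.
split.
- exists (X 0 1); last exact: sharp_plane_disc_congr X_sharp.
  by apply: dord_geW (ord_eq_dord_ge X01) _; lia.
- move=> _ nsq; apply: (sharp_pair_plane _ X_dom); [by []|lia|].
  apply/negP => prod_large; apply: nsq; exists (X 0 1).
  rewrite vdisc disc_mx2 // addrAC subrr add0r dord_geN.
  by apply: dord_geW prod_large _; lia.
- by move=> [_]; rewrite vdisc; lia.
Qed.

Lemma sharp_plane_block0 h (X : 'M[F]_2) (Y : 'M_0) (a : 'I_(2 + 0) -> int) :
  dominated h (block_mx X 0 0 Y) a -> sharp_plane h X (a \o @lshift 2 0) ->
  sharp_plane h (block_mx X 0 0 Y : 'M_2) a.
Proof.
have lshiftK (i : 'I_2) : lshift 0 i = i :> 'I_2 by apply: val_inj.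
have XY01 : (block_mx X 0 0 Y : 'M_2) 0 1 = X 0 1.
  by rewrite -(block_mxEul X (0 : 'M_(2, 0)) 0 Y) !lshiftK.
by move=> XY_dom [_ [r X01]]; rewrite /= !lshiftK => vr; split=> //; exists r; rewrite ?XY01.
Qed.

(* Once a plane of excess 1 splits off, equality in the bounds is impossible on a
   nonzero complement. *)
Lemma disc_estimate_half_block m (X : 'M[F]_2) (Y : 'M_m) a :
  (0 < m)%N -> sharp_plane 1 X (a \o @lshift 2 m) ->
  disc_estimate_half Y (a \o @rshift 2 m) -> disc_estimate_half (block_mx X 0 0 Y) a.
Proof.
move=> m0 X_sharp; have [X0 vX0] := sharp_plane_disc (lexx 1) X_sharp.
have [_ [r _]] := X_sharp; rewrite /= in vX0 * => vr.
rewrite /disc_estimate_half /disc_estimate disc_block // oddD /=.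
set S : int := \sum_(i < 2 + m) a i; set S' : int := \sum_k a (rshift 2 k).
have sum_a : S = a (lshift m 0) + a (lshift m 1) + S' by rewrite /S big_split_ord sum_ord2.
move=> [Y_est /(_ m0) Y_half].
have disc_ge : dord_ge (disc X * disc Y) (2 * S + 4).
  by apply: dord_geM (dord_ge_v _) Y_half _; lia.
split; last by move=> _; apply: dord_geW disc_ge _; lia.
move: Y_est; case: (odd m) => [_|[[P hP DP] _ _]].
  by split=> [|/ord_eq_exclude-/(_ _ disc_ge)[]]; [apply: dord_geW disc_ge _|]; lia.
split=> [|/ord_eq_exclude-/(_ _ disc_ge)[]|[XY0 vXY] odd_S]; first 2 last.
- have Y0 : disc Y != 0 by apply: contraNneq XY0 => ->; rewrite mulr0.
  have vY : v (disc Y) = S' + 1 by move: vXY; rewrite vM //; lia.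
  have [] : ord_eq (P ^+ 2) (S' + 1).
    by apply: ord_eq_congr (conj Y0 vY) (dord_geW DP _); lia.
  by rewrite expf_eq0 /= => P0; rewrite vX //; lia.
- by exists 0; rewrite ?dord_ge0 // expr0n subr0.
- by lia.
Qed.

Lemma disc_estimate_half_dominated1 n (A : 'M[F]_n) a : dominated 1 A a -> disc_estimate_half A a.
Proof.
apply: (@plane_ind 1 disc_estimate_half) => {n A a} //.
- exact: disc_estimate_half_congr.
- move=> n A a A_dom; split; first exact: disc_estimate_dominated2.
  by move=> n0; apply: dord_geW (dominated_disc (lexx 2) A_dom) _; lia.
move=> [|m] X Y a X_sharp XY_dom Y_est; last exact: disc_estimate_half_block.
exact: disc_estimate_half_plane (sharp_plane_block0 XY_dom X_sharp).
Qed.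

Section PlaneExcess0.
Variables (m : nat) (X : 'M[F]_2) (Y : 'M[F]_m) (a : 'I_(2 + m) -> int).
Hypothesis X_sharp : sharp_plane 0 X (a \o @lshift 2 m).

Let S : int := \sum_k a (rshift 2 k).
Let D := disc Y.

Let discX : ord_eq (disc X) (a (lshift m 0) + a (lshift m 1)).
Proof. by have := sharp_plane_disc ler01 X_sharp; rewrite addr0. Qed.

Let congrX : dord_ge (disc X - X 0 1 ^+ 2) (2 * (a (lshift m 0) + a (lshift m 1)) + 4).
Proof. exact: sharp_plane_disc_congr X_sharp. Qed.

Let sum_a : \sum_i a i = a (lshift m 0) + a (lshift m 1) + S.
Proof. by rewrite big_split_ord sum_ord2. Qed.

Let disc_cancel k : ord_eq (disc X * D) (a (lshift m 0) + a (lshift m 1) + k) -> ord_eq D k.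
Proof.
have [X0 vX0] := discX; move=> [XD0].
have D0 : D != 0 by apply: contraNneq XD0 => ->; rewrite mulr0.
by rewrite vM // vX0 => /addrI.
Qed.

Lemma disc_estimate_block_odd :
  odd m -> disc_estimate Y (a \o @rshift 2 m) -> disc_estimate (block_mx X 0 0 Y) a.
Proof.
move=> odd_m; rewrite /disc_estimate oddD odd_m disc_block //= sum_a -/S -/D => -[bound sharp].
split; first by apply: dord_geM (ord_eq_dord_ge discX) bound _; lia.
rewrite -addrA => XD; have Deq := disc_cancel XD; have [D0 vD] := Deq.
have [X0 vX0] := discX.
have [k [c [P [sharp_c hP]]]] := sharp Deq.
exists k, (col_mx 0 c), (X 0 1 * P); split; first exact: sharp_vec_block.
have -> : qform (block_mx X 0 0 Y) (col_mx 0 c) = qform Y c.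
  rewrite /qform /bform mul_block_col !mulmx0 !mul0mx addr0 add0r.
  by rewrite tr_col_mx mul_row_col mulmx0 add0r.
set q := qform Y c in hP *.
have -> : disc X * D - q * (X 0 1 * P) ^+ 2 =
    disc X * (D - q * P ^+ 2) + (disc X - X 0 1 ^+ 2) * (q * P ^+ 2) by ring.
have hqP : dord_ge (q * P ^+ 2) (2 * v D).
  by rewrite -[q * _](subKr D); apply: dord_geB (dord_ge_v D) (dord_geW hP _); lia.
rewrite vM //; apply: dord_geD; first by apply: dord_geM (dord_ge_v _) hP _; lia.
by apply: dord_geM congrX hqP _; lia.
Qed.

Lemma disc_estimate_block_even :
  ~~ odd m -> disc_estimate Y (a \o @rshift 2 m) -> disc_estimate (block_mx X 0 0 Y) a.
Proof.
move=> /negPf even_m; rewrite /disc_estimate oddD even_m disc_block //= sum_a -/S -/D.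
move=> [[P hP DP] sharp1 sharp2]; have [X0 vX0] := discX; have [_ [r X01 vr]] := X_sharp.
split.
- exists (X 0 1 * P); first by apply: dord_geM (ord_eq_dord_ge X01) hP _; move: vr => /=; lia.
  have -> : disc X * D - (X 0 1 * P) ^+ 2 = disc X * (D - P ^+ 2) + (disc X - X 0 1 ^+ 2) * P ^+ 2.
    by ring.
  apply: dord_geD; first by apply: dord_geM (ord_eq_dord_ge discX) DP _; lia.
  by apply: dord_geM congrX (dord_geX hP (lexx _)) _; lia.
- rewrite -addrA => /disc_cancel Deq nsq; have [D0 _] := Deq.
  apply: sharp_pair_block; apply: sharp1 Deq _ => sqD; apply: nsq.
  apply: sq_mod4M => //; exists (X 0 1).
  by apply: dord_geW congrX _; rewrite vX0; lia.
- rewrite -addrA => /disc_cancel Deq odd_S; apply: sharp_pair_block; apply: sharp2 Deq _.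
  by move: odd_S vr => /=; lia.
Qed.

End PlaneExcess0.

Lemma disc_estimate_dominated n (A : 'M[F]_n) a : dominated 0 A a -> disc_estimate A a.
Proof.
apply: (@plane_ind 0 disc_estimate) => {n A a} //.
- exact: disc_estimate_congr.
- by move=> n A a; rewrite add0r => /disc_estimate_half_dominated1[].
move=> m X Y a X_sharp _; have [odd_m|even_m] := boolP (odd m).
  exact: disc_estimate_block_odd.
exact: disc_estimate_block_even.
Qed.

(* [s = Delta(B)] for [D = (-1)^[n/2] det(2B)].  For even [n] this is
   [ord D - ord disc(F(sqrt D)/F) + 1 - xi^2], the discriminant having order 0, 2, 3
   in the three cases. *)
Definition is_Delta n (D : F) (s : int) : Prop :=
  D != 0 /\
  if odd n then v D = s + 1
  else [\/ sq_mod4 D /\ v D = s, [/\ ~ sq_mod4 D, ~~ odd `|v D|%N & v D = s + 1]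
         | odd `|v D|%N /\ v D = s + 2].

Lemma Delta_bound n (A : 'M[F]_n) a s :
  dominated 0 A a -> is_Delta n (disc A) s -> \sum_i a i <= s.
Proof.
move=> /disc_estimate_dominated; rewrite /disc_estimate /is_Delta.
set S := \sum_i a i; set D := disc A => est [D0]; move: est; case: (odd n).
  by move=> [bound _] vD; move: bound; rewrite dord_geE //; lia.
move=> [[P hP DP] _ _].
have vD : S <= v D.
  have : dord_ge D (2 * S).
    rewrite -[D](subrK (P ^+ 2)); apply: dord_geD (dord_geW DP _) (dord_geX hP _); lia.
  by rewrite dord_geE //; lia.
case=> [[_ <-]//|[nsq _ vDs]|[odd_vD vDs]]; case: (lerP S s) => // lt_sS.
  by case: nsq; exists P; apply: dord_geW DP _; lia.
have [] : ord_eq (P ^+ 2) (v D) by apply: ord_eq_congr (conj D0 erefl) (dord_geW DP _); lia.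
by rewrite expf_eq0 /= => P0; rewrite vX //; lia.
Qed.

(** * A criterion for the Gross-Keating invariant *)

Lemma is_Delta_mulsq n n' D P s :
  odd n = odd n' -> P != 0 -> is_Delta n D s -> is_Delta n' (D * P ^+ 2) (s + 2 * v P).
Proof.
move=> nn' P0 [D0]; rewrite /is_Delta -nn' mulf_neq0 ?expf_neq0 // vM ?expf_neq0 // vX //.
case: (odd n) => [->|h]; split=> //; first by lia.
case: h => [[sqD vD]|[nsqD even_vD vD]|[odd_vD vD]].
- by apply: Or31; split; [apply/sq_mod4_mulsq|lia].
- by apply: Or32; split; [rewrite sq_mod4_mulsq|lia|lia].
- by apply: Or33; split; lia.
Qed.

Section AdjoinDual.
Variables p q : nat.
Implicit Types A : 'M[F]_(p + q).
Let E : 'M[F]_(p + q, q) := col_mx 0 1%:M.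
Let E' : 'M[F]_(q, p + q) := row_mx 0 1%:M.
Let swap : 'M[F]_(p + q + q) := block_mx (block_mx 1%:M 0 0 0) E E' 0.

Let det_swap : \det swap = (-1) ^+ q.
Proof.
have swap_unip : block_mx 1%:M E 0 1%:M *m swap =
    block_mx 1%:M 0 E' 1%:M *m block_mx 1%:M E 0 (- 1%:M).
  have EE' : E *m E' = block_mx 0 0 0 1%:M.
    by rewrite mul_col_row !mulmx0 ?mul0mx mulmx1.
  have E'E : E' *m E = 1%:M by rewrite mul_row_col mulmx0 mulmx1 add0r.
  rewrite !mulmx_block !(mul0mx, mulmx0, mul1mx, mulmx1, addr0, add0r) EE' E'E subrr.
  by rewrite add_block_mx !(addr0, add0r) -scalar_mx_block.
have := congr1 determinant swap_unip.
rewrite !det_mulmx !det_ublock !det_lblock !det1 !mul1r => ->.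
by rewrite -scaleN1r detZ det1 mulr1.
Qed.

Lemma det_adjoin_dual A (t : F) :
  \det (block_mx A (t *: E) (t *: E') 0) = \det (ulsubmx A) * (-1) ^+ q * (t ^+ q) ^+ 2.
Proof.
pose L := block_mx (ulsubmx A) 0 (dlsubmx A) t%:M; pose R := col_mx (ursubmx A) (drsubmx A).
have LE : L *m E = t *: E.
  by rewrite mul_block_col !(mulmx0, mulmx1, add0r) scale_col_mx scaler0 scalemx1.
have LRA : L *m block_mx 1%:M 0 0 0 + R *m E' = A.
  rewrite mulmx_block mul_col_row add_block_mx.
  by rewrite !(mulmx0, mulmx1, add0r, addr0) submxK.
have -> : block_mx A (t *: E) (t *: E') 0 = block_mx L R 0 t%:M *m swap.
  by rewrite mulmx_block LE LRA !(mul0mx, mulmx0, add0r, addr0) mul_scalar_mx.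
rewrite det_mulmx det_swap det_ublock det_lblock !det_scalar; ring.
Qed.

Lemma disc_adjoin_dual A (t : F) :
  disc (block_mx A (t *: E) (t *: E') 0) = disc (ulsubmx A) * (t ^+ q) ^+ 2.
Proof.
rewrite /disc det_adjoin_dual; have -> : ((p + q + q)./2 = p./2 + q)%N by lia.
by rewrite exprD -(signr_odd F q); case: (odd q); rewrite ?expr0 ?expr1; ring.
Qed.

Lemma disc_congr_adjoin_dual A (U : 'M[F]_(p + q)) (t : F) :
  disc (block_mx (U^T *m A *m U) (U^T *m (t *: E)) (U^T *m (t *: E))^T 0) =
  disc (ulsubmx A) * (t ^+ q * \det U) ^+ 2.
Proof.
pose V : 'M[F]_(p + q + q) := block_mx U 0 0 1%:M.
have tE : (t *: E)^T = t *: E' by rewrite linearZ /= tr_col_mx trmx0 trmx1.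
have -> : block_mx (U^T *m A *m U) (U^T *m (t *: E)) (U^T *m (t *: E))^T 0 =
    V^T *m block_mx A (t *: E) (t *: E') 0 *m V.
  rewrite tr_block_mx !trmx0 trmx1 !mulmx_block trmx_mul trmxK tE.
  by rewrite !(mul0mx, mulmx0, mul1mx, mulmx1, addr0, add0r).
by rewrite disc_congr disc_adjoin_dual det_ublock det1 mulr1; ring.
Qed.

End AdjoinDual.

Definition extend d (a : nat -> nat) c j := if (j < d)%N then a j else c.

Lemma extend_lshift d e a c (i : 'I_d) : extend d a c (lshift e i) = a i.
Proof. by rewrite /extend /= ltn_ord. Qed.

Lemma extend_rshift d e a c (i : 'I_e) : extend d a c (rshift d i) = c.
Proof. by rewrite /extend /= ltnNge leq_addr. Qed.

Lemma sum_extend d e a c :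
  \sum_(j < d + e) (extend d a c j)%:Z = \sum_(j < d) (a j)%:Z + (e * c)%N%:Z.
Proof.
rewrite big_split_ord /=; congr (_ + _).
  by apply: eq_bigr => j _; rewrite -(extend_lshift e a c j).
under eq_bigr => j _ do rewrite -[(d + j)%N]/(nat_of_ord (rshift d j)) extend_rshift.
by rewrite sumz_const mulrC.
Qed.

Lemma extend_jump d a c p :
  (extend d a c p.-1 < extend d a c p)%N -> (p <= d)%N /\ (p = d \/ (a p.-1 < a p)%N).
Proof.
rewrite /extend; have [lt_pd|le_dp] := ltnP p d.
  by rewrite (leq_ltn_trans (leq_pred p) lt_pd) => jump_a; split; [apply: ltnW|right].
by have [lt_p1d _|_] := ltnP p.-1 d; rewrite ?ltnn //; split; [|left]; lia.
Qed.

Local Notation weights a := (fun i => (a (nat_of_ord i))%:Z).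

Lemma dominated_adjoin n q (X : 'M[F]_n) (Y : 'M_(n, q)) b m :
  dominated 0 X (weights b) -> (forall i k, dord_ge (Y i k) ((b i)%:Z + m%:Z)) ->
  dominated 0 (block_mx X Y Y^T 0) (weights (extend n b m)).
Proof.
move=> [symX diag offdiag] hY; split=> [|i|i j].
- by rewrite tr_block_mx symX trmx0 trmxK.
- case: (split_ordP i) => i' ->; first by rewrite block_mxEul extend_lshift; apply: diag.
  by rewrite block_mxEdr mxE dord_ge0.
case: (split_ordP i) => i' ->; case: (split_ordP j) => j' ->; rewrite ?extend_lshift ?extend_rshift.
- by rewrite block_mxEul (inj_eq (@lshift_inj _ _)); apply: offdiag.
- by rewrite block_mxEur addr0.
- by rewrite block_mxEdl mxE addr0 addrC.
- by rewrite block_mxEdr mxE dord_ge0.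
Qed.

Lemma capped_weights_bound p q (M U : 'M[F]_(p + q)) (b : nat -> nat) m s :
  in_GLo v U -> (forall j : 'I_(p + q), (b j <= m)%N) ->
  dominated 0 (2 *: (U^T *m M *m U)) (weights b) ->
  is_Delta p (disc (2 *: ulsubmx M)) s -> \sum_(j < p + q) (b j)%:Z <= s + (q * m)%N%:Z.
Proof.
move=> [intU [U0 vU]] b_le UMU_dom M_Delta; have [t0 vt] := ord_eq_pow2 m.
set t : F := 2 ^+ m in t0 vt.
pose E : 'M[F]_(p + q, q) := t *: col_mx 0 1%:M.
have hUE i k : dord_ge ((U^T *m E) i k) ((b i)%:Z + m%:Z).
  have hE l : dord_ge (E l k) (2 * m%:Z).
    rewrite mxE; apply: dord_geM (ord_eq_dord_ge (conj t0 vt)) (_ : dord_ge _ 0) _; last by lia.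
    case: (split_ordP l) => l' ->; first by rewrite col_mxEu mxE dord_ge0.
    by rewrite col_mxEd -[0](subrr 0); apply: (dord_ge_mx1 (fun=> 0)).
  rewrite mxE; apply: dord_ge_sum => l _; rewrite mxE.
  by have /in_oE hU := intU l i; apply: dord_geM hU (hE l) _; have := b_le i; lia.
have UMU : 2 *: (U^T *m M *m U) = U^T *m (2 *: M) *m U by rewrite -scalemxAr -scalemxAl.
have ulM : ulsubmx (2 *: M) = 2 *: ulsubmx M by apply/matrixP => i j; rewrite !mxE.
have [tU0 vtU] := ord_eqM (ord_eqX q (conj t0 vt)) (conj U0 vU).
have parity : odd p = odd (p + q + q) by lia.
have := is_Delta_mulsq parity tU0 M_Delta; rewrite -ulM -disc_congr_adjoin_dual -UMU vtU.
by move/(Delta_bound (dominated_adjoin UMU_dom hUE)); rewrite sum_extend; lia.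
Qed.

Definition entry n (M : 'M[F]_n) (i j : nat) : F :=
  if (insub i, insub j) is (Some i', Some j') then M i' j' else 0.

Lemma entryE n (M : 'M[F]_n) (i j : 'I_n) : entry M i j = M i j.
Proof. by rewrite /entry !valK. Qed.

Definition lead p n (M : 'M[F]_n) : 'M[F]_p := mxn p (entry M).

Lemma lead_full n (M : 'M[F]_n) : lead n M = M.
Proof. by apply/matrixP => i j; rewrite mxE entryE. Qed.

Lemma lead_ulsubmx p q (M : 'M[F]_(p + q)) : lead p M = ulsubmx M.
Proof. by apply/matrixP => i j; rewrite !mxE -[LHS]/(entry M (lshift q i) (lshift q j)) entryE. Qed.

Definition saturated n (M : 'M[F]_n) (a : nat -> nat) : Prop :=
  [/\ M^T = M, in_S v M (fun i => a i) &
    forall p, (p <= n)%N -> p = n \/ (a p.-1 < a p)%N ->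
      is_Delta p (disc (2 *: lead p M)) (\sum_(j < p) (a j)%:Z)].

Lemma in_S_dominated n (M : 'M[F]_n) (a : 'I_n -> nat) :
  M^T = M -> in_S v M a -> dominated 0 (2 *: M) (fun i => (a i)%:Z).
Proof.
move=> symM [_ [diag offdiag]]; split=> [|i|i j _]; first by rewrite linearZ /= symM.
  by rewrite mxE; have /ord_geE h := diag i; apply: dord_ge_mul2 h _; lia.
have le_entry (k l : 'I_n) : (k <= l)%N -> dord_ge (2 * M k l) ((a k)%:Z + (a l)%:Z + 0).
  by move=> /offdiag[->|h]; rewrite ?dord_ge0 // addr0 /dord_ge h orbT.
rewrite mxE; have [/le_entry//|/ltnW/le_entry] := leqP i j.
by rewrite -[in 2 * M i j]symM mxE [(a j)%:Z + _]addrC.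
Qed.

Lemma lex_le_or_gt n (a a' : 'I_n -> nat) :
  lex_le a' a \/ exists i : 'I_n, (a i < a' i)%N /\ forall j : 'I_n, (j < i)%N -> a' j = a j.
Proof.
have [/existsP[x hx]|/existsPn eq_a] := boolP [exists i, a' i != a i]; last first.
  by left; left => i; apply/eqP; have := eq_a i; rewrite negbK.
have [i hi imin] := arg_minnP (P := fun i => a' i != a i) (fun i : 'I_n => nat_of_ord i) hx.
have eq_lt (j : 'I_n) : (j < i)%N -> a' j = a j.
  by move=> ji; apply/eqP; apply: contraLR ji => hj; rewrite -leqNgt; apply: imin.
case: (ltngtP (a' i) (a i)) hi => // lt_i _; first by left; right; exists i.
by right; exists i.
Qed.

Lemma next_jump n (a : nat -> nat) i :
  (forall j k, (j <= k < n)%N -> (a j <= a k)%N) -> (i < n)%N ->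
  exists p, [/\ (i < p <= n)%N, p = n \/ (a p.-1 < a p)%N &
                forall j, (i <= j < p)%N -> a j = a i].
Proof.
move=> a_mono lt_in; pose jump p := (i < p)%N && ((p == n) || (a i < a p)%N).
have exp : exists p, jump p by exists n; rewrite /jump lt_in eqxx.
have [p /andP[ip hp] pmin] := ex_minnP exp.
have pn : (p <= n)%N by apply: pmin; rewrite /jump lt_in eqxx.
have a_const j : (i <= j < p)%N -> a j = a i.
  move=> /andP[ij jp]; apply/eqP; rewrite eqn_leq [(a i <= a j)%N]a_mono ?andbT; last by lia.
  have [->//|neq_ij] := eqVneq i j; rewrite leqNgt; apply/negP => lt_a.
  by have := pmin j; rewrite /jump lt_a orbT andbT; lia.
exists p; split=> //; first by rewrite ip.
by case/orP: hp => [/eqP|lt_a]; [left|right; rewrite a_const //; lia].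
Qed.

Lemma in_GLo1 n : in_GLo v (1%:M : 'M_n).
Proof.
split=> [i j|]; last by rewrite det1; apply: ord_eq1.
by apply/in_oE; rewrite -[0](subrr 0); apply: (dord_ge_mx1 (fun=> 0)).
Qed.

Lemma saturated_GK n (M : 'M[F]_n) (a : nat -> nat) : saturated M a -> is_GK v M (fun i => a i).
Proof.
move=> [symM aM a_Delta]; split.
  by exists 1%:M; rewrite trmx1 mul1mx mulmx1; split=> //; apply: in_GLo1.
move=> U a' intU a'M; have [//|[i [lt_a eq_a]]] := lex_le_or_gt (fun i : 'I_n => a i) a'.
have [a_mono _] := aM; have [a'_mono _] := a'M.
have a_monoN j k : (j <= k < n)%N -> (a j <= a k)%N.
  by move=> /andP[jk kn]; apply: (a_mono (Ordinal (leq_ltn_trans jk kn)) (Ordinal kn)).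
have [p [/andP[ip pn] jump_p a_const]] := next_jump a_monoN (ltn_ord i).
have [q def_n] : exists q, n = (p + q)%N by exists (n - p)%N; lia.
have M_Delta := a_Delta p pn jump_p; subst n; rewrite lead_ulsubmx in M_Delta.
pose b j := if (j < i)%N then a j else (a i).+1.
have b_le_a' (j : 'I_(p + q)) : (b j <= a' j)%N.
  by rewrite /b; case: ltnP => [/eq_a->//|ij]; apply: leq_trans lt_a (a'_mono i j ij).
have b_le (j : 'I_(p + q)) : (b j <= (a i).+1)%N.
  by rewrite /b; case: ltnP => // ji; apply: leqW; apply: a_mono; apply: ltnW.
have symUMU : (U^T *m M *m U)^T = U^T *m M *m U by rewrite !trmx_mul trmxK symM mulmxA.
have UMU_dom : dominated 0 (2 *: (U^T *m M *m U)) (weights b).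
  by apply: dominatedW (in_S_dominated symUMU a'M) => k; rewrite lez_nat.
have := capped_weights_bound intU b_le UMU_dom M_Delta.
have -> : \sum_(j < p + q) (b j)%:Z = \sum_(j < p) (b j)%:Z + (q * (a i).+1)%N%:Z.
  rewrite -sum_extend; apply: eq_bigr => j _; rewrite /extend; case: ltnP => // pj.
  by rewrite /b ltnNge (leq_trans (ltnW ip) pj).
suff lt_sum : \sum_(j < p) (a j)%:Z < \sum_(j < p) (b j)%:Z by rewrite lerD2r leNgt lt_sum.
pose i' : 'I_p := Ordinal ip; rewrite (bigD1 i') //= [ltRHS](bigD1 i') //=.
apply: ltr_leD; first by rewrite /b ltnn; lia.
by apply: ler_sum => k _; rewrite /b; case: ltnP => // ik; rewrite a_const ?ik ?ltn_ord //; lia.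
Qed.

(** * Appending a block *)

Definition saturated_basis d (B : 'M[F]_d) (a : nat -> nat) (U : 'M[F]_d) : Prop :=
  in_GLo v U /\ saturated (U^T *m B *m U) a.

Lemma in_S_intro n (M : 'M[F]_n) (a : 'I_n -> nat) :
  (forall i j : 'I_n, (i <= j)%N -> (a i <= a j)%N) ->
  (forall i, dord_ge (M i i) (2 * (a i)%:Z)) ->
  (forall i j : 'I_n, (i < j)%N -> dord_ge (2 * M i j) ((a i)%:Z + (a j)%:Z)) -> in_S v M a.
Proof.
move=> a_mono diag offdiag; split=> //; split=> [i|i j]; first exact/ord_geE.
rewrite leq_eqVlt => ij; have : dord_ge (2 * M i j) ((a i)%:Z + (a j)%:Z).
  case/orP: ij => [/eqP/val_inj<-|]; last exact: offdiag.
  by apply: dord_ge_mul2 (diag i) _; lia.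
by case/orP => [/eqP|]; [left|right; rewrite PoszD].
Qed.

Lemma in_GLo_block d e (U : 'M[F]_d) (w : 'M_(d, e)) :
  in_GLo v U -> (forall i j, dord_ge (w i j) 0) -> in_GLo v (block_mx U (U *m w) 0 1%:M).
Proof.
move=> [intU detU] int_w; have [int1 _] := in_GLo1 e.
split=> [i j|]; last by rewrite det_ublock det1 mulr1.
case: (split_ordP i) => i' ->; case: (split_ordP j) => j' ->.
- by rewrite block_mxEul.
- rewrite block_mxEur mxE; apply/in_oE; apply: dord_ge_sum => l _.
  by have /in_oE hU := intU i' l; apply: dord_geM hU (int_w l j') _.
- by rewrite block_mxEdl mxE; left.
- by rewrite block_mxEdr.
Qed.

Lemma congr_block d e (B : 'M[F]_d) (C : 'M_e) U (w : 'M_(d, e)) :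
  let M := U^T *m B *m U in
  (block_mx U (U *m w) 0 1%:M)^T *m block_mx B 0 0 C *m block_mx U (U *m w) 0 1%:M =
  block_mx M (M *m w) (w^T *m M) (C + w^T *m M *m w).
Proof.
move=> M; rewrite tr_block_mx trmx0 trmx1 !mulmx_block !mulmx0 !mul0mx !mul1mx !mulmx1.
by rewrite !addr0 !add0r trmx_mul /M !mulmxA [C + _]addrC.
Qed.

Definition weights_le n (a : nat -> nat) (c : nat) : Prop := forall i, (i < n)%N -> (a i <= c)%N.

Lemma in_S_block d e (M : 'M[F]_d) (X : 'M_(d, e)) (Z : 'M_(e, d)) (Y : 'M_e)
    (a : nat -> nat) c :
  in_S v M (fun i => a i) -> weights_le d a c ->
  (forall i j, dord_ge (2 * X i j) ((a i)%:Z + c%:Z)) ->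
  (forall j, dord_ge (Y j j) (2 * c%:Z)) ->
  (forall i j, i != j -> dord_ge (2 * Y i j) (2 * c%:Z)) ->
  in_S v (block_mx M X Z Y) (fun i => extend d a c i).
Proof.
move=> [a_mono [diagM offM]] a_le hX diagY offY.
apply: in_S_intro => [i j|i|i j].
- case: (split_ordP i) => i' ->; case: (split_ordP j) => j' -> ij;
    rewrite ?extend_lshift ?extend_rshift //; [exact: a_mono|exact: a_le|].
  by move: ij; have := ltn_ord j'; rewrite /=; lia.
- case: (split_ordP i) => i' ->; rewrite ?extend_lshift ?extend_rshift.
    by rewrite block_mxEul; apply/ord_geE.
  by rewrite block_mxEdr.
case: (split_ordP i) => i' ->; case: (split_ordP j) => j' -> ij;
  rewrite ?extend_lshift ?extend_rshift.
- rewrite block_mxEul; have [->|M_ij] := offM i' j' (ltnW ij); first exact: dord_ge0.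
  by rewrite /dord_ge; lia.
- by rewrite block_mxEur.
- by move: ij; have := ltn_ord j'; rewrite /=; lia.
- rewrite block_mxEdr; apply: dord_geW (offY i' j' _) _; last by lia.
  by apply: contraTneq ij => ->; rewrite ltnn.
Qed.

Lemma entry_block d e (X : 'M[F]_d) (Y : 'M_(d, e)) (Z : 'M_(e, d)) (T : 'M_e) i j :
  (i < d)%N -> (j < d)%N -> entry (block_mx X Y Z T) i j = entry X i j.
Proof.
move=> hi hj; have := block_mxEul X Y Z T (Ordinal hi) (Ordinal hj).
by rewrite -(entryE (block_mx X Y Z T)) -(entryE X).
Qed.

Lemma lead_block d e (X : 'M[F]_d) (Y : 'M_(d, e)) (Z : 'M_(e, d)) (T : 'M_e) p :
  (p <= d)%N -> lead p (block_mx X Y Z T) = lead p X.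
Proof.
move=> pd; apply/matrixP => i j; rewrite !mxE entry_block //.
  exact: leq_trans (ltn_ord i) pd.
exact: leq_trans (ltn_ord j) pd.
Qed.

Lemma entry_block_dl0 d e (X : 'M[F]_d) (Y : 'M_(d, e)) (T : 'M_e) i j :
  (d <= i)%N -> (i < d + e)%N -> (j < d)%N -> entry (block_mx X Y 0 T) i j = 0.
Proof.
move=> di ie jd; pose i' := Ordinal ie; pose j' := lshift e (Ordinal jd).
rewrite -[LHS]/(entry _ i' j') entryE /i' /j'.
case: (split_ordP (Ordinal ie)) => [l /(congr1 val) /= eq_l|l ->]; last by rewrite block_mxEdl mxE.
by have := ltn_ord l; rewrite -eq_l ltnNge di.
Qed.

Lemma lead_unipotent d e (X : 'M[F]_d) (Y : 'M_(d, e.+1)) :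
  lead (d + 1) (block_mx X Y 0 1%:M) = block_mx X (col 0 Y) 0 1%:M.
Proof.
apply/matrixP => i j; rewrite mxE.
case: (split_ordP i) => i' ->; case: (split_ordP j) => j' ->.
- by rewrite block_mxEul entry_block //= entryE.
- rewrite block_mxEur mxE ord1.
  by rewrite -[LHS]/(entry _ (lshift e.+1 i') (rshift d (0 : 'I_e.+1))) entryE block_mxEur.
- by rewrite block_mxEdl mxE entry_block_dl0 //= ?leq_addr // ltn_add2l (leq_trans (ltn_ord i')).
- rewrite block_mxEdr !ord1 -[LHS]/(entry _ (rshift d (0 : 'I_e.+1)) (rshift d (0 : 'I_e.+1))).
  by rewrite entryE block_mxEdr !mxE.
Qed.

Definition qdisc n (B : 'M[F]_n) : F := disc (2 *: B).

Lemma qdisc_congr n (B U : 'M[F]_n) : qdisc (U^T *m B *m U) = qdisc B * \det U ^+ 2.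
Proof. by rewrite -disc_congr /qdisc -scalemxAr -scalemxAl. Qed.

Lemma is_Delta_congr d (B U : 'M[F]_d) s :
  in_GLo v U -> is_Delta d (qdisc (U^T *m B *m U)) s <-> is_Delta d (qdisc B) s.
Proof.
move=> [_ [U0 vU]]; rewrite qdisc_congr; split=> h.
  have [V0 vV] := ord_eqV (conj U0 vU).
  by have := is_Delta_mulsq erefl V0 h; rewrite vV oppr0 mulr0 addr0 exprVn mulfK ?expf_neq0.
by have := is_Delta_mulsq erefl U0 h; rewrite vU mulr0 addr0.
Qed.

Lemma saturated_basis_Delta d (B : 'M[F]_d) a U :
  saturated_basis B a U -> is_Delta d (qdisc B) (\sum_(j < d) (a j)%:Z).
Proof.
move=> [intU [_ _ /(_ d (leqnn d) (or_introl erefl))]].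
by rewrite lead_full -/(qdisc _) is_Delta_congr.
Qed.

Lemma saturated_basis_append d e (B : 'M[F]_d) (C : 'M_e) U a (w : 'M_(d, e)) c :
  let M := U^T *m B *m U in
  C^T = C -> saturated_basis B a U -> (forall i j, dord_ge (w i j) 0) ->
  weights_le d a c ->
  (forall (i : 'I_d) j, dord_ge ((2 *: M *m w) i j) ((a i)%:Z + c%:Z)) ->
  (forall j, dord_ge ((C + w^T *m M *m w) j j) (2 * c%:Z)) ->
  (forall i j, i != j -> dord_ge (2 * (C + w^T *m M *m w) i j) (2 * c%:Z)) ->
  is_Delta (d + e) (qdisc (block_mx B 0 0 C)) (\sum_(j < d) (a j)%:Z + (e * c)%N%:Z) ->
  saturated_basis (block_mx B 0 0 C) (extend d a c) (block_mx U (U *m w) 0 1%:M).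
Proof.
move=> M symC [intU [symM aM a_Delta]] int_w a_le hMw diag offdiag BC_Delta.
have intU' := in_GLo_block intU int_w; split=> //.
rewrite congr_block -/M; rewrite -/M in symM; split.
- move: (M) symM => N symN.
  by rewrite tr_block_mx !linearD /= !trmx_mul !trmxK symC symN mulmxA.
- apply: in_S_block => // i j; move: (hMw i j).
  by rewrite -scalemxAl mxE.
move=> p; rewrite leq_eqVlt => /orP[/eqP-> _|pd jump_p].
  by rewrite lead_full -congr_block -/(qdisc _) is_Delta_congr // sum_extend.
have [|pd' jump_a] := @extend_jump d a c p; first by case: jump_p => // e_p; lia.
rewrite lead_block //.
have -> : \sum_(j < p) (extend d a c j)%:Z = \sum_(j < p) (a j)%:Z.
  by apply: eq_bigr => j _; rewrite /extend (leq_trans (ltn_ord j) pd').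
exact: a_Delta.
Qed.

Section DeltaStep.
Variables (d : nat) (D D' : F) (s k : int).
Hypotheses (D_Delta : is_Delta d D s) (D'_ord : ord_eq D' (v D + k + 1)).

(* the weight of a vector of level [k] orthogonal to a lattice of rank [d] and
   discriminant [D] cannot be raised, or can be raised to [k + 2], if adjoining it
   gives the discriminant [D'] *)
Definition weight_kept : Prop := if odd d then (odd `|v D'|%N : Prop) else sq_mod4 D.
Definition weight_plus2 : Prop := if odd d then sq_mod4 D' else odd `|v D|%N.

Lemma weight_plus2_not_kept : weight_plus2 -> ~ weight_kept.
Proof.
have [D0 _] := D_Delta; have [D'0 _] := D'_ord; rewrite /weight_plus2 /weight_kept.
case: (odd d) => [sqD' odd_D'|odd_D sqD].
  by have := sq_mod4_even D'0 sqD'; rewrite odd_D'.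
by have := sq_mod4_even D0 sqD; rewrite odd_D.
Qed.

Lemma Delta_kept : weight_kept -> is_Delta (d + 1) D' (s + k).
Proof.
have [D'0 vD'] := D'_ord; have [D0 hD] := D_Delta; move: hD.
rewrite /weight_kept /is_Delta addn1 /=.
case: (odd d) => /= [vD odd_vD'|hD sqD]; split=> //; first by apply: Or33; split=> //; lia.
case: hD => [[_ h]|[//]|[odd_vD _]]; first by lia.
by have := sq_mod4_even D0 sqD; rewrite odd_vD.
Qed.

Lemma Delta_plus1 : ~ weight_kept -> ~ weight_plus2 -> is_Delta (d + 1) D' (s + (k + 1)).
Proof.
have [D'0 vD'] := D'_ord; have [D0 hD] := D_Delta; move: hD.
rewrite /weight_kept /weight_plus2 /is_Delta addn1 /=.
case: (odd d) => /= [vD even_vD' nsqD'|hD nsqD even_vD]; split=> //.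
  by apply: Or32; split=> //; [apply/negP|lia].
by case: hD => [[//]|[_ _ vD]|[//]]; lia.
Qed.

Lemma Delta_plus2 : weight_plus2 -> is_Delta (d + 1) D' (s + (k + 2)).
Proof.
have [D'0 vD'] := D'_ord; have [D0 hD] := D_Delta; move: hD.
rewrite /weight_plus2 /is_Delta addn1 /=.
case: (odd d) => /= [vD sqD'|hD odd_vD]; split=> //; first by apply: Or31; split=> //; lia.
case: hD => [[sqD _]|[_ even_vD _]|[_ h]]; last by lia.
  by have := sq_mod4_even D0 sqD; rewrite odd_vD.
by rewrite odd_vD in even_vD.
Qed.

End DeltaStep.

Lemma Delta_diag2 d D D' s (k : int) :
  is_Delta d D s -> ord_eq D' (v D + 2 * k + 2) ->
  odd d \/ odd `|v D|%N \/ (~ sq_mod4 D /\ ~ sq_mod4 D') -> is_Delta (d + 2) D' (s + 2 * (k + 1)).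
Proof.
move=> [D0 hD] [D'0 vD'] cond; rewrite /is_Delta addn2 /= negbK; split=> //; move: hD.
have [odd_d|/negP even_d] := boolP (odd d); first by lia.
case=> [[sqD vD]|[nsqD even_vD vD]|[odd_vD vD]].
- by case: cond => [//|[odd_vD|[//]]]; have := sq_mod4_even D0 sqD; rewrite odd_vD.
- case: cond => [//|[odd_vD|[_ nsqD']]]; first by rewrite odd_vD in even_vD.
  by apply: Or32; split=> //; lia.
- by apply: Or33; split; lia.
Qed.

Lemma Delta_mul_sq_mod4 n D E s (k : int) :
  is_Delta n D s -> ord_eq E (2 * k) -> sq_mod4 E -> is_Delta n (D * E) (s + 2 * k).
Proof.
move=> [D0 hD] [E0 vE] sqE; split; rewrite ?mulf_neq0 // vM // vE; move: hD.
case: (odd n) => [vD|]; first by lia.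
case=> [[sqD vD]|[nsqD even_vD vD]|[odd_vD vD]].
- by apply: Or31; split; [apply: sq_mod4M|lia].
- by apply: Or32; split; [rewrite sq_mod4_mulr|lia|lia].
- by apply: Or33; split; lia.
Qed.

(** * Raising the weight of a vector *)

Section SharpVectors.
Variables (d : nat) (A : 'M[F]_d) (a : 'I_d -> int).
Hypothesis A_dom : dominated 0 A a.

Lemma sharp_vecW k (h h' : int) x : h' <= h -> sharp_vec A a k h x -> sharp_vec A a k h' x.
Proof.
by move=> hh [lev_x qx orth_x]; split=> // j; apply: dord_geW (orth_x j) _; lia.
Qed.

Lemma sharp_vecZ k h x (l : int) : sharp_vec A a k h x -> sharp_vec A a (k + 2 * l) h (2 ^ l *: x).
Proof.
move=> [lev_x qx orth_x]; have pow_l := ord_eq_pow2z l.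
split=> [||j].
- by apply: levelZ (ord_eq_dord_ge pow_l) lev_x _; lia.
- by rewrite qformZ; have [? ?] := ord_eqM (ord_eqX 2 pow_l) qx; split=> //; lia.
- rewrite -scalemxAr mxE.
  by apply: dord_geM (ord_eq_dord_ge pow_l) (orth_x j) _; lia.
Qed.

Lemma sharp_vec_level k k' h x :
  ~~ odd `|(k' - k)%R|%N -> sharp_vec A a k h x -> exists l : int, sharp_vec A a k' h (2 ^ l *: x).
Proof.
move=> even_kk' sharp_x; pose l := ((k' - k) %/ 2)%Z; exists l.
by have -> : k' = k + 2 * l by [rewrite /l; lia]; apply: sharp_vecZ.
Qed.

Lemma sharp_pair_level h k : sharp_pair A a h -> exists x, sharp_vec A a k h x.
Proof.
move=> [k1 [x1 [k2 [x2 [odd_k12 sharp1 sharp2]]]]].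
have [odd_k|even_k] := boolP (odd `|(k - k1)%R|%N); last first.
  by have [l sharp_x] := sharp_vec_level even_k sharp1; exists (2 ^ l *: x1).
have even_k : ~~ odd `|(k - k2)%R|%N by lia.
by have [l sharp_x] := sharp_vec_level even_k sharp2; exists (2 ^ l *: x2).
Qed.

Hypothesis A_Delta : is_Delta d (disc A) (\sum_i a i).

Lemma sharp_vec_even k : ~~ odd d -> ~ sq_mod4 (disc A) -> exists x, sharp_vec A a k 1 x.
Proof.
move=> /negPf even_d nsq; have := disc_estimate_dominated A_dom.
rewrite /disc_estimate even_d => -[_ sharp1 sharp2]; move: A_Delta.
rewrite /is_Delta even_d => -[D0 [[//]|[_ _ vD]|[odd_vD vD]]].
  by apply: sharp_pair_level; apply: sharp1.
have [|x sharp_x] := @sharp_pair_level 2 k; last by exists x; apply: sharp_vecW sharp_x.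
by apply: sharp2 => //; lia.
Qed.

Lemma sharp_vec_even_odd k :
  ~~ odd d -> odd `|v (disc A)|%N -> exists x, sharp_vec A a k 2 x.
Proof.
move=> /negPf even_d odd_vD; have := disc_estimate_dominated A_dom.
rewrite /disc_estimate even_d => -[_ _ sharp2]; apply: sharp_pair_level; move: A_Delta.
rewrite /is_Delta even_d => -[D0 [[sqD _]|[_ even_vD _]|[_ vD]]].
- by have := sq_mod4_even D0 sqD; rewrite odd_vD.
- by rewrite odd_vD in even_vD.
- by apply: sharp2 => //; lia.
Qed.

Lemma sharp_vec_odd k : odd d -> odd `|(v (disc A) - k)%R|%N ->
  exists x P, [/\ P != 0, sharp_vec A a k 2 x &
    dord_ge (disc A - qform A x * P ^+ 2) (2 * v (disc A) + 4)].
Proof.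
move=> odd_d odd_vDk; have := disc_estimate_dominated A_dom.
rewrite /disc_estimate odd_d => -[_ sharp]; move: A_Delta; rewrite /is_Delta odd_d => -[D0 vD].
have [k1 [x [P [sharp_x hP]]]] := sharp (conj D0 vD); have [_ [q0 vq] _] := sharp_x.
have [] := ord_eq_congr (conj D0 erefl) (dord_geW hP _ : dord_ge _ (2 * v (disc A) + 1)).
  by lia.
rewrite mulf_eq0 expf_eq0 /= negb_or => /andP[_ P0]; rewrite vM ?expf_neq0 // vX // vq => vqP.
have [|l sharp_lx] := @sharp_vec_level k1 k 2 x _ sharp_x; first by lia.
have [p0 _] := ord_eq_pow2z l.
exists (2 ^ l *: x), (P / 2 ^ l); split=> //; first by rewrite mulf_neq0 ?invr_eq0.
have -> // : qform A (2 ^ l *: x) * (P / 2 ^ l) ^+ 2 = qform A x * P ^+ 2.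
by rewrite qformZ; field.
Qed.

Lemma sharp_vec_exists k :
  (odd d -> odd `|(v (disc A) - k)%R|%N) -> (~~ odd d -> ~ sq_mod4 (disc A)) ->
  exists x, sharp_vec A a k 1 x.
Proof.
move=> parity nsq; have [odd_d|even_d] := boolP (odd d).
  have [x [_ [_ sharp_x _]]] := sharp_vec_odd odd_d (parity odd_d).
  by exists x; apply: sharp_vecW sharp_x.
exact: sharp_vec_even (nsq even_d).
Qed.

(* Adding [x] to a new vector of value [c] and level [k], orthogonal to the old
   lattice, makes [l] an admissible weight for it. *)
Definition corrects (k : int) (c : F) (l : int) (x : 'cV[F]_d) : Prop :=
  [/\ level a k x, forall i, dord_ge ((A *m x) i 0) (a i + l) &
      dord_ge (c + qform A x / 2) (2 * l)].

Lemma correctsW k c (l l' : int) x : l' <= l -> corrects k c l x -> corrects k c l' x.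
Proof.
move=> ll' [lev_x orth_x hx]; split=> // [i|]; last by apply: dord_geW hx _; lia.
by apply: dord_geW (orth_x i) _; lia.
Qed.

Lemma corrects0 (k : int) c : dord_ge c (2 * k) -> corrects k c k 0.
Proof.
move=> hc; split=> [i|i|]; rewrite ?mulmx0 ?mxE ?dord_ge0 //.
by rewrite /qform /bform trmx0 mul0mx mxE mul0r addr0.
Qed.

Lemma sharp_vec_half k h x : sharp_vec A a k h x -> ord_eq (qform A x / 2) k.
Proof.
by move=> [_ qx _]; have := ord_eqM qx (ord_eqV ord_eq2); rewrite addrK.
Qed.

Lemma corrects_sharp1 (k : int) c x :
  dord_ge c (2 * k) -> sharp_vec A a k 1 x ->
  exists2 s, dord_ge s 0 & corrects k c (k + 1) (s *: x).
Proof.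
move=> hc sharp_x; have q_ord := sharp_vec_half sharp_x; have [lev_x _ orth_x] := sharp_x.
set q := qform A x / 2 in q_ord; have [q0 _] := q_ord.
have [|s int_s hs] := @residue_sqrt (- c / q).
  by apply: dord_ge_div q_ord _ _; [rewrite dord_geN; apply: hc|lia].
exists s => //; split=> [|i|]; first by apply: levelZ int_s lev_x _; lia.
  by rewrite -scalemxAr mxE; apply: dord_geM int_s (orth_x i) _; lia.
have -> : c + qform A (s *: x) / 2 = - (q * (- c / q - s ^+ 2)).
  by rewrite qformZ -mulrA -/q; field.
by rewrite dord_geN; apply: dord_geM (ord_eq_dord_ge q_ord) hs _; lia.
Qed.

Lemma corrects_sharp2 k c x :
  ord_eq c k -> sharp_vec A a k 2 x -> sq_mod4 (- c * (qform A x / 2)) ->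
  exists s, corrects k c (k + 2) (s *: x).
Proof.
move=> c_ord sharp_x; have q_ord := sharp_vec_half sharp_x; have [lev_x _ orth_x] := sharp_x.
set q := qform A x / 2 in q_ord *; have [q0 _] := q_ord.
have [D0 vD] := ord_eqM (ord_eqN c_ord) q_ord.
move=> /(sq_mod4_root D0) [P [[_ vP] hP]].
have int_s : dord_ge (P / q) 0 by apply: dord_ge_div q_ord (dord_ge_v P) _; lia.
exists (P / q); split=> [|i|]; first by apply: levelZ int_s lev_x _; lia.
  by rewrite -scalemxAr mxE; apply: dord_geM int_s (orth_x i) _; lia.
have -> : c + qform A (P / q *: x) / 2 = - ((- c * q - P ^+ 2) / q).
  by rewrite qformZ -mulrA -/q; field.
by rewrite dord_geN; apply: dord_ge_div q_ord hP _; lia.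
Qed.

Lemma correctsD (k : int) c x y :
  corrects k c (k + 1) x -> (forall i, dord_ge ((A *m x) i 0) (a i + (k + 2))) ->
  corrects (k + 1) (c + qform A x / 2) (k + 2) y -> corrects k c (k + 2) (x + y).
Proof.
move=> [lev_x _ _] orth_x [lev_y orth_y hxy]; have [symA _ _] := A_dom.
split=> [|i|].
- by apply: levelD lev_x _ => i; apply: dord_geW (lev_y i) _; lia.
- by rewrite mulmxDr mxE; apply: dord_geD.
have bxy : dord_ge (bform A x y) (2 * (k + 2)).
  apply: dord_ge_round; rewrite bformC // bformE; apply: dord_ge_sum => i _.
  by apply: dord_geM (lev_y i) (orth_x i) _; lia.
have -> : c + qform A (x + y) / 2 = c + qform A x / 2 + qform A y / 2 + bform A x y.
  by rewrite qformD //; field; case: ord_eq2.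
exact: dord_geD.
Qed.

Lemma corrects_sharp_pair (k : int) c x y :
  dord_ge c (2 * k) -> sharp_vec A a k 2 x -> sharp_vec A a (k + 1) 2 y ->
  exists z, corrects k c (k + 2) z.
Proof.
move=> hc sharp_x sharp_y.
have le12 : 1 <= 2 :> int by [].
have [s int_s sx] := corrects_sharp1 hc (sharp_vecW le12 sharp_x).
have [_ _ hsx] := sx; have [_ _ orth_x] := sharp_x.
have [t _ ty] := corrects_sharp1 hsx (sharp_vecW le12 sharp_y).
exists (s *: x + t *: y); apply: correctsD sx _ _ => [i|].
  by rewrite -scalemxAr mxE; apply: dord_geM int_s (orth_x i) _; lia.
by rewrite -[k + 2]/(k + (1 + 1)) addrA.
Qed.

(* the discriminant of the orthogonal sum of a form of rank [d] and discriminant [D]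
   with the form [c x^2] *)
Definition append_disc (d : nat) (D c : F) : F := (-1) ^+ odd d * (D * (2 * c)).

Lemma ord_append_disc n D c (k : int) :
  D != 0 -> ord_eq c k -> ord_eq (append_disc n D c) (v D + k + 1).
Proof.
move=> D0 c_ord; have [Dc0 vDc] := ord_eqM (conj D0 erefl) (ord_eqM ord_eq2 c_ord).
rewrite /append_disc; case: (odd n); rewrite ?mulN1r ?mul1r; split; rewrite ?oppr_eq0 ?vN //; lia.
Qed.

Section Corrections.
Variables (k : int) (c : F).
Hypothesis c_ord : ord_eq c k.
Let D' := append_disc d (disc A) c.

Lemma corrects_plus1 c' : ~ weight_kept d (disc A) D' -> dord_ge c' (2 * k) ->
  exists x, corrects k c' (k + 1) x.
Proof.
move=> not_kept hc'; have [D0 _] := A_Delta; have [_ vD'] := ord_append_disc d D0 c_ord.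
have [| |x sharp_x] := @sharp_vec_exists k; last 1 first.
- by have [s _ hs] := corrects_sharp1 hc' sharp_x; exists (s *: x).
- by move=> odd_d; move: not_kept; rewrite /weight_kept odd_d => /negP; rewrite vD'; lia.
- by move=> /negPf even_d; move: not_kept; rewrite /weight_kept even_d.
Qed.

Lemma corrects_plus2 : weight_plus2 d (disc A) D' -> exists x, corrects k c (k + 2) x.
Proof.
have [D0 _] := A_Delta; have [D'0 vD'] := ord_append_disc d D0 c_ord; have [c0 _] := c_ord.
rewrite /weight_plus2; have [odd_d sqD'|even_d odd_vD] := boolP (odd d); last first.
  have [x sharp_x] := sharp_vec_even_odd k even_d odd_vD.
  have [y sharp_y] := sharp_vec_even_odd (k + 1) even_d odd_vD.
  exact: corrects_sharp_pair (ord_eq_dord_ge c_ord) sharp_x sharp_y.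
have even_vD' := sq_mod4_even D'0 sqD'.
have [|x [P [P0 sharp_x hP]]] := sharp_vec_odd (k := k) odd_d; first by lia.
have [q0 _] := sharp_vec_half sharp_x; have [t0 _] := ord_eq2.
suff [s hs] : exists s, corrects k c (k + 2) (s *: x) by exists (s *: x).
apply: corrects_sharp2 c_ord sharp_x _.
have nc0 : - c != 0 by rewrite oppr_eq0.
apply/(sq_mod4_mulsq (mulf_neq0 nc0 q0) (mulf_neq0 t0 P0)).
apply: sq_mod4_congr D'0 sqD' _.
have -> : D' - - c * (qform A x / 2) * (2 * P) ^+ 2 = - (2 * c) * (disc A - qform A x * P ^+ 2).
  by rewrite /D' /append_disc odd_d expr1; field.
have h2c : dord_ge (- (2 * c)) (2 * (k + 1)).
  by rewrite dord_geN; apply: dord_ge_mul2 (ord_eq_dord_ge c_ord) _; lia.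
by apply: dord_geM h2c hP _; rewrite vD'; lia.
Qed.

End Corrections.

End SharpVectors.

Section MulUnitSquare.
Variables (d : nat) (D D' u : F).
Hypotheses (D0 : D != 0) (D'0 : D' != 0) (u_unit : ord_eq u 0).

Let v_mulsq x : x != 0 -> v (x * u ^+ 2) = v x.
Proof. by move=> x0; have [u0 vu] := u_unit; rewrite vM ?expf_neq0 // vX // vu mulr0 addr0. Qed.

Lemma weight_kept_mulsq : weight_kept d (D * u ^+ 2) (D' * u ^+ 2) <-> weight_kept d D D'.
Proof.
have [u0 _] := u_unit; rewrite /weight_kept; case: (odd d); first by rewrite v_mulsq.
exact: sq_mod4_mulsq.
Qed.

Lemma weight_plus2_mulsq : weight_plus2 d (D * u ^+ 2) (D' * u ^+ 2) <-> weight_plus2 d D D'.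
Proof.
have [u0 _] := u_unit; rewrite /weight_plus2; case: (odd d); last by rewrite v_mulsq.
exact: sq_mod4_mulsq.
Qed.

End MulUnitSquare.

Lemma ord_qdiscE n (B : 'M[F]_n) k : ord_eq (qdisc B) k <-> ord_eq (\det (2 *: B)) k.
Proof.
rewrite /qdisc /disc -signr_odd; case: odd; rewrite ?mulN1r ?mul1r //.
by split=> /ord_eqN; rewrite ?opprK.
Qed.

Lemma ord_qdisc_block d e (B : 'M[F]_d) (C : 'M_e) k l :
  ord_eq (qdisc B) k -> ord_eq (qdisc C) l -> ord_eq (qdisc (block_mx B 0 0 C)) (k + l).
Proof.
move=> /ord_qdiscE hB /ord_qdiscE hC; apply/ord_qdiscE.
by rewrite scale_block_mx !scaler0 det_ublock; apply: ord_eqM.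
Qed.

Lemma ord_qdisc_diag e (c : 'rV[F]_e) (k : int) :
  (forall j, ord_eq (c 0 j) k) -> ord_eq (qdisc (diag_mx c)) (e%:Z * (k + 1)).
Proof.
move=> hc; apply/ord_qdiscE; rewrite detZ det_diag mulrDr mulr1 addrC.
apply: ord_eqM (ord_eq_pow2 e) _.
have <- : \sum_(j < e) k = e%:Z * k by rewrite sumz_const mulrC.
elim/big_rec2: _ => [|j l x _ hx]; first exact: ord_eq1.
exact: ord_eqM (hc j) hx.
Qed.

Lemma qdisc_append_diag1 d (B : 'M[F]_d) (c : 'rV_1) :
  qdisc (block_mx B 0 0 (diag_mx c)) = append_disc d (qdisc B) (c 0 0).
Proof.
rewrite /qdisc /append_disc /disc scale_block_mx !scaler0 det_ublock.
rewrite [\det (2 *: diag_mx c)]detZ det_diag big_ord1.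
have -> : ((d + 1)./2 = d./2 + odd d)%N by lia.
by rewrite exprD expr1; ring.
Qed.

Section Append.
Variables (d : nat) (B : 'M[F]_d) (a : nat -> nat) (U : 'M[F]_d).
Hypothesis basis : saturated_basis B a U.
Let M := U^T *m B *m U.
Let A := 2 *: M.
Let D := qdisc B.
Let S : int := \sum_(j < d) (a j)%:Z.

Let intU : in_GLo v U. Proof. by case: basis. Qed.
Let U_unit : ord_eq (\det U) 0. Proof. by case: intU. Qed.
Let D_Delta : is_Delta d D S. Proof. exact: saturated_basis_Delta basis. Qed.
Let D0 : D != 0. Proof. by case: D_Delta. Qed.
Let A_dom : dominated 0 A (weights a).
Proof. by have [_ [symM aM _]] := basis; apply: in_S_dominated. Qed.
Let discA : disc A = D * \det U ^+ 2. Proof. exact: qdisc_congr. Qed.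
Let A_Delta : is_Delta d (disc A) (\sum_(i < d) (a i)%:Z).
Proof. by rewrite -/(qdisc _) is_Delta_congr. Qed.

Lemma saturated_basis_append_diag e (c : 'rV_e) (w : 'M_(d, e)) (k l : nat) :
  weights_le d a k.+1 -> weights_le d a l ->
  (forall j, corrects A (weights a) k (c 0 j) l (col j w)) -> ((1 < e)%N -> (l <= k.+1)%N) ->
  is_Delta (d + e) (qdisc (block_mx B 0 0 (diag_mx c))) (S + (e * l)%N%:Z) ->
  saturated_basis (block_mx B 0 0 (diag_mx c)) (extend d a l) (block_mx U (U *m w) 0 1%:M).
Proof.
move=> a_le_k a_le_l w_corr l_le Delta_e.
have bformA x y : bform A x y = 2 * bform M x y by rewrite /bform -scalemxAl -scalemxAr mxE.
have [t0 _] := ord_eq2.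
apply: saturated_basis_append => //= [|i j|i j|j|i j ij].
- by rewrite tr_diag_mx.
- have [lev_w _ _] := w_corr j; have := lev_w i; rewrite mxE => h.
  by apply: (@dord_ge_round _ 0); apply: dord_geW h _; have := a_le_k i (ltn_ord i); lia.
- have [_ orth_w _] := w_corr j; have := orth_w i.
  by rewrite colE mulmxA -colE mxE.
- have [_ _] := w_corr j; rewrite /qform bformA [in X in _ -> X]mxE congr_mxE mxE eqxx mulr1n.
  by rewrite [2 * _]mulrC mulfK.
- rewrite mxE congr_mxE mxE (negPf ij) mulr0n add0r -bformA.
  have [lev_i _ _] := w_corr i; have [_ orth_j _] := w_corr j.
  apply: dord_ge_round; rewrite bformE; apply: dord_ge_sum => t _.
  have le_l : (l <= k.+1)%N.
    by apply: l_le; have := ltn_ord i; have := ltn_ord j; move: ij; rewrite -val_eqE /=; lia.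
  by apply: dord_geM (lev_i t) (orth_j t) _; lia.
Qed.

Lemma saturated_basis_append_plane (C : 'M[F]_2) (k : nat) :
  C^T = C -> weights_le d a k ->
  (forall j, dord_ge (C j j) (2 * k%:Z)) -> (forall i j, dord_ge (2 * C i j) (2 * k%:Z)) ->
  ord_eq (qdisc C) (2 * k%:Z) -> sq_mod4 (qdisc C) ->
  exists w, saturated_basis (block_mx B 0 0 C) (extend d a k) (block_mx U (U *m w) 0 1%:M).
Proof.
move=> symC a_le diagC entryC C_ord sqC; exists 0.
apply: saturated_basis_append => // [i j|i j|j|i j _|].
- by rewrite mxE dord_ge0.
- by rewrite mulmx0 mxE dord_ge0.
- by rewrite mulmx0 addr0.
- by rewrite mulmx0 addr0.
have even_d : odd (d + 2) = odd d by lia.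
rewrite /qdisc scale_block_mx !scaler0 disc_block ?andbF // -!/(qdisc _) /is_Delta even_d.
exact: Delta_mul_sq_mod4 D_Delta C_ord sqC.
Qed.

Section AppendDiag1.
Variables (c : 'rV[F]_1) (k : nat).
Hypothesis c_ord : ord_eq (c 0 0) k.
Let D' := append_disc d D (c 0 0).

Let D'_ord : ord_eq D' (v D + k%:Z + 1). Proof. exact: ord_append_disc D0 c_ord. Qed.
Let D'0 : D' != 0. Proof. by case: D'_ord. Qed.
Let append_discA : append_disc d (disc A) (c 0 0) = D' * \det U ^+ 2.
Proof. by rewrite discA /D' /append_disc; ring. Qed.

Let append_w (l : nat) (x : 'cV_d) :
  weights_le d a k.+1 -> weights_le d a l ->
  corrects A (weights a) k (c 0 0) l x -> is_Delta (d + 1) D' (S + l%:Z) ->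
  saturated_basis (block_mx B 0 0 (diag_mx c)) (extend d a l) (block_mx U (U *m x) 0 1%:M).
Proof.
move=> a_le_k a_le_l x_corr; rewrite /D' /D -qdisc_append_diag1 => Delta_l.
apply: saturated_basis_append_diag a_le_k a_le_l _ _ _ => //; last by rewrite mul1n.
by move=> j; rewrite ord1 col_id.
Qed.

Lemma corrects_plus1_basis c' :
  ~ weight_kept d D D' -> dord_ge c' (2 * k%:Z) ->
  exists x, corrects A (weights a) k c' k.+1 x.
Proof.
move=> not_kept hc'; rewrite -[k.+1]addn1 PoszD.
apply: (corrects_plus1 A_dom A_Delta c_ord) hc'.
by rewrite append_discA discA weight_kept_mulsq.
Qed.

Lemma corrects_plus2_basis :
  weight_plus2 d D D' -> exists x, corrects A (weights a) k (c 0 0) k.+2 x.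
Proof.
move=> plus2; rewrite -[k.+2]addn2 PoszD; apply: (corrects_plus2 A_dom A_Delta c_ord).
by rewrite append_discA discA weight_plus2_mulsq.
Qed.

Lemma saturated_basis_append_kept :
  weight_kept d D D' -> weights_le d a k -> exists x,
  saturated_basis (block_mx B 0 0 (diag_mx c)) (extend d a k) (block_mx U (U *m x) 0 1%:M).
Proof.
move=> kept a_le; exists 0; apply: append_w => // [i /a_le||]; first by lia.
  by apply: corrects0; apply: ord_eq_dord_ge.
exact: Delta_kept D_Delta D'_ord kept.
Qed.

Lemma saturated_basis_append_plus1 :
  ~ weight_kept d D D' -> ~ weight_plus2 d D D' -> weights_le d a k.+1 ->
  exists x,
  saturated_basis (block_mx B 0 0 (diag_mx c)) (extend d a k.+1) (block_mx U (U *m x) 0 1%:M).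
Proof.
move=> not_kept not_plus2 a_le.
have [x x_corr] := corrects_plus1_basis not_kept (ord_eq_dord_ge c_ord).
exists x; apply: append_w => //.
by rewrite -[k.+1]addn1 PoszD; apply: Delta_plus1 D_Delta D'_ord not_kept not_plus2.
Qed.

Lemma saturated_basis_append_plus2 x :
  weight_plus2 d D D' -> weights_le d a k.+1 ->
  corrects A (weights a) k (c 0 0) k.+2 x ->
  saturated_basis (block_mx B 0 0 (diag_mx c)) (extend d a k.+2) (block_mx U (U *m x) 0 1%:M).
Proof.
move=> plus2 a_le x_corr; apply: append_w => // [i /a_le|]; first by lia.
by rewrite -[k.+2]addn2 PoszD; apply: Delta_plus2 D_Delta D'_ord plus2.
Qed.

End AppendDiag1.

Lemma saturated_basis_append_diag2 (c : 'rV[F]_2) (k : nat) w :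
  (forall j, ord_eq (c 0 j) k) -> weights_le d a k.+1 ->
  (forall j, corrects A (weights a) k (c 0 j) k.+1 (col j w)) ->
  odd d \/ odd `|v D|%N \/ (~ sq_mod4 D /\ ~ sq_mod4 (qdisc (block_mx B 0 0 (diag_mx c)))) ->
  saturated_basis (block_mx B 0 0 (diag_mx c)) (extend d a k.+1) (block_mx U (U *m w) 0 1%:M).
Proof.
move=> c_ord a_le w_corr cond; apply: (saturated_basis_append_diag a_le a_le w_corr) => //.
have [D''0 vD''] := ord_qdisc_block (conj D0 erefl) (ord_qdisc_diag c_ord).
rewrite -[k.+1]addn1 PoszM PoszD; apply: Delta_diag2 D_Delta _ cond.
by split=> //; rewrite vD'' /D; lia.
Qed.

Lemma saturated_basis_append_twin (c : 'rV[F]_2) (k : nat) :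
  (forall j, ord_eq (c 0 j) k) -> weight_plus2 d D (append_disc d D (c 0 0)) ->
  weights_le d a k.+1 -> exists w : 'M_(d, 2),
  saturated_basis (block_mx B 0 0 (diag_mx c)) (extend d a k.+1) (block_mx U (U *m w) 0 1%:M) /\
  saturated_basis (block_mx B 0 0 (diag_mx (const_mx (c 0 0) : 'rV_1))) (extend d a k.+2)
    (block_mx U (U *m col 0 w) 0 1%:M).
Proof.
move=> c_ord plus2 a_le; pose c0 := const_mx (c 0 0) : 'rV[F]_1.
have c0E : c0 0 0 = c 0 0 by rewrite mxE.
have c0_ord : ord_eq (c0 0 0) k by rewrite c0E.
have not_kept := weight_plus2_not_kept D_Delta (ord_append_disc d D0 c0_ord).
rewrite -c0E in plus2.
have [x x_corr] := corrects_plus2_basis c0_ord plus2.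
have [y y_corr] := corrects_plus1_basis c0_ord (not_kept plus2) (ord_eq_dord_ge (c_ord 1)).
pose w : 'M_(d, 2) := \matrix_(i, j) (if j == 0 then x i 0 else y i 0).
have w0 : col 0 w = x by apply/colP => i; rewrite !mxE.
have w1 : col 1 w = y by apply/colP => i; rewrite !mxE.
exists w; rewrite w0; split; last exact: saturated_basis_append_plus2 c0_ord _ plus2 a_le x_corr.
apply: saturated_basis_append_diag2 c_ord a_le _ _ => [j|].
  case: (ord2P j) => ->; rewrite ?w0 ?w1 // -c0E.
  by apply: correctsW x_corr; lia.
by move: plus2; rewrite /weight_plus2; case: (odd d); [left|right; left].
Qed.

Lemma saturated_basis_append_level (c : 'rV[F]_2) (k : nat) :
  (forall j, ord_eq (c 0 j) k) -> weights_le d a k.+1 ->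
  (odd d -> odd `|(v D - k%:Z)%R|%N) ->
  (~~ odd d -> ~ sq_mod4 D /\ ~ sq_mod4 (qdisc (block_mx B 0 0 (diag_mx c)))) ->
  exists w : 'M_(d, 2),
  saturated_basis (block_mx B 0 0 (diag_mx c)) (extend d a k.+1) (block_mx U (U *m w) 0 1%:M).
Proof.
move=> c_ord a_le parity nsq.
have x_exists j : exists x, corrects A (weights a) k (c 0 j) k.+1 x.
  have [u0 vu] := U_unit; rewrite -[k.+1]addn1 PoszD.
  have [|even_d|x sharp_x] := sharp_vec_exists A_dom A_Delta (k := k).
  - by rewrite discA vM ?expf_neq0 // vX // vu mulr0 addr0.
  - by rewrite discA sq_mod4_mulsq //; case: (nsq even_d).
  - have [s _ hs] := corrects_sharp1 (ord_eq_dord_ge (c_ord j)) sharp_x.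
    by exists (s *: x).
have [x x_corr] := fin_all_exists x_exists; pose w : 'M_(d, 2) := \matrix_(i, j) x j i 0.
exists w; apply: saturated_basis_append_diag2 c_ord a_le _ _ => [j|].
  by have -> : col j w = x j by apply/colP => i; rewrite !mxE.
by have [odd_d|/nsq] := boolP (odd d); [left|right; right].
Qed.

End Append.

(** * Block sums *)

Definition blk_mx (b : blk F) : 'M[F]_(blk_deg b) := mxn (blk_deg b) (blk_entry b).

Lemma totdeg_cat (l1 l2 : seq (blk F)) : totdeg (l1 ++ l2) = (totdeg l1 + totdeg l2)%N.
Proof. by rewrite /totdeg map_cat sumn_cat. Qed.

Lemma totdeg_rcons (l : seq (blk F)) b : totdeg (rcons l b) = (totdeg l + blk_deg b)%N.
Proof. by rewrite -cats1 totdeg_cat /totdeg /= addn0. Qed.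

Lemma bmat_cat (l1 l2 : seq (blk F)) i j :
  bmat (l1 ++ l2) i j =
  if (i < totdeg l1)%N && (j < totdeg l1)%N then bmat l1 i j
  else if (totdeg l1 <= i)%N && (totdeg l1 <= j)%N
       then bmat l2 (i - totdeg l1) (j - totdeg l1) else 0.
Proof.
elim: l1 i j => [|b l1 IH] i j /=; first by rewrite /totdeg /= !subn0.
have -> : totdeg (b :: l1) = (blk_deg b + totdeg l1)%N by [].
rewrite IH !subnDA; set d := blk_deg b; set t := totdeg l1.
have ltD x : (d <= x)%N -> (x < d + t)%N = (x - d < t)%N by lia.
have leD x : (d <= x)%N -> (d + t <= x)%N = (t <= x - d)%N by lia.
have lt_ltD x : (x < d)%N -> (x < d + t)%N by lia.
have lt_leD x : (x < d)%N -> (d + t <= x)%N = false by lia.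
case: (ltnP i d) => id; case: (ltnP j d) => jd /=.
- by rewrite !lt_ltD.
- by rewrite lt_leD //=; case: ifP.
- by rewrite (lt_leD j) // andbF; case: ifP.
- by rewrite !ltD ?leD.
Qed.

Lemma bmat1 (b : blk F) i j :
  bmat [:: b] i j = if (i < blk_deg b)%N && (j < blk_deg b)%N then blk_entry b i j else 0.
Proof. by rewrite /=; case: ifP => // _; case: ifP. Qed.

Lemma mxn_bmat_rcons (l : seq (blk F)) b :
  mxn (totdeg l + blk_deg b) (bmat (rcons l b)) = block_mx (Bof l) 0 0 (blk_mx b).
Proof.
apply/matrixP => i j; rewrite mxE -cats1 bmat_cat bmat1.
case: (split_ordP i) => i' ->; case: (split_ordP j) => j' -> /=.
- by rewrite block_mxEul mxE.
- by rewrite block_mxEur mxE leqNgt ltn_ord.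
- by rewrite block_mxEdl mxE [(_ <= j')%N]leqNgt ltn_ord andbF.
- by rewrite block_mxEdr mxE !leq_addr !addKn !ltn_ord.
Qed.

Lemma bmat_merge_diag (l : seq (blk F)) k us ws :
  bmat (rcons (rcons l (BDiag k us)) (BDiag k ws)) =2 bmat (rcons l (BDiag k (us ++ ws))).
Proof.
have tot1 : totdeg [:: BDiag k us] = size us by rewrite /totdeg /= addn0.
move=> i j; rewrite -!cats1 -catA !bmat_cat !bmat1 tot1 /= size_cat.
do 2!case: ifP => // _; move: (i - _)%N (j - _)%N => {}i {}j; rewrite nth_cat.
case: (ltnP i (size us)) => hi; case: (ltnP j (size us)) => hj /=.
- by rewrite !ltn_addr.
- by rewrite (ltn_eqF (leq_trans hi hj)) if_same.
- by rewrite (gtn_eqF (leq_trans hj hi)) if_same.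
have lt_sub x : (size us <= x)%N -> (x < size us + size ws)%N = (x - size us < size ws)%N by lia.
by rewrite !lt_sub // -(eqn_add2r (size us)) !subnK.
Qed.

Lemma blk_mx_diag k (us : seq F) :
  blk_mx (BDiag k us) = diag_mx (\row_i (2 ^+ k * us`_i)).
Proof.
by apply/matrixP => i j; rewrite !mxE /= -val_eqE; case: eqP => _; rewrite ?mulr1n ?mulr0n.
Qed.

Lemma ord_eq_pow2_unit k u : unit_o v u -> ord_eq (2 ^+ k * u) k.
Proof. by move=> hu; have := ord_eqM (ord_eq_pow2 k) hu; rewrite addr0. Qed.

Lemma ord_qdisc_blk_diag k us : blk_wf v (BDiag k us) ->
  ord_eq (qdisc (blk_mx (BDiag k us))) ((size us)%:Z * (k%:Z + 1)).
Proof.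
move=> [_ us_unit]; rewrite blk_mx_diag; apply: ord_qdisc_diag => j; rewrite mxE.
by apply: ord_eq_pow2_unit; apply: us_unit; apply: mem_nth.
Qed.

Section NonDiagonalBlock.
Variables (k : nat) (a b c : F).
Hypothesis wf : blk_wf v (BNon k a b c).
Let C : 'M[F]_2 := blk_mx (BNon k a b c).

Let pow_k : dord_ge (2 ^+ k) (2 * k%:Z). Proof. exact: ord_eq_dord_ge (ord_eq_pow2 k). Qed.
Let C_off i j : i != j -> 2 * C i j = 2 ^+ k * b.
Proof.
have [t0 _] := ord_eq2.
by case: (ord2P i) => ->; case: (ord2P j) => -> //; rewrite mxE /= => _; field.
Qed.

Lemma blk_non_sym : C^T = C.
Proof.
apply/matrixP => i j; rewrite mxE; have [->//|ij] := eqVneq i j; have [t0 _] := ord_eq2.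
by apply: (mulfI t0); rewrite !C_off // eq_sym.
Qed.

Lemma blk_non_diag j : dord_ge (C j j) (2 * k%:Z).
Proof.
have [/in_oE int_a [_ [/in_oE int_c _]]] := wf; rewrite -[2 * _]addr0.
by case: (ord2P j) => ->; rewrite mxE /=; apply: dord_geM pow_k _ (lexx _).
Qed.

Lemma blk_non_entry i j : dord_ge (2 * C i j) (2 * k%:Z).
Proof.
have [<-|ij] := eqVneq i j; first by apply: dord_ge_mul2 (blk_non_diag i) _; lia.
by have [_ [/in_oE int_b _]] := wf; rewrite C_off //; apply: dord_geM pow_k int_b _; lia.
Qed.

Let qdiscC : qdisc C = (2 ^+ k) ^+ 2 * (b ^+ 2 - 4 * a * c).
Proof.
rewrite /qdisc disc_mx2; last by rewrite linearZ /= blk_non_sym.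
have scaleC i j : (2 *: C) i j = 2 * C i j by rewrite mxE.
by rewrite !scaleC C_off // !mxE /=; ring.
Qed.

Lemma ord_qdisc_blk_non : ord_eq (qdisc C) (2 * k%:Z).
Proof.
have [_ [_ [_ /ord_eqN]]] := wf; rewrite opprB qdiscC => hn.
by have := ord_eqM (ord_eqX 2 (ord_eq_pow2 k)) hn; rewrite addr0.
Qed.

Lemma sq_mod4_blk_non : sq_mod4 (qdisc C).
Proof.
have [_ vC] := ord_qdisc_blk_non; exists (2 ^+ k * b); rewrite vC qdiscC.
have [/in_oE int_a [_ [/in_oE int_c _]]] := wf.
have -> : (2 ^+ k) ^+ 2 * (b ^+ 2 - 4 * a * c) - (2 ^+ k * b) ^+ 2 =
    - ((2 ^+ k) ^+ 2 * (4 * (a * c))) by ring.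
rewrite dord_geN; apply: dord_geM (dord_geX pow_k (lexx _)) (_ : dord_ge _ 4) _; last by lia.
by apply: dord_geM (ord_eq_dord_ge ord_eq4) (dord_geM int_a int_c (lexx _)) _.
Qed.

End NonDiagonalBlock.

Definition flag_basis (l : seq (blk F)) (b : blk F) (a : nat -> nat) (u : nat -> nat -> F) : Prop :=
  [/\ saturated_basis (Bof (rcons l b)) a (mxn (totdeg (rcons l b)) u),
      exists a', saturated_basis (Bof l) a' (mxn (totdeg l) u) &
      forall i j, (totdeg l <= i)%N -> (i < totdeg (rcons l b))%N -> (j < totdeg l)%N ->
        u i j = 0].

Lemma flag_basis_append l b a a2 U w :
  saturated_basis (Bof l) a U ->
  saturated_basis (block_mx (Bof l) 0 0 (blk_mx b)) a2 (block_mx U (U *m w) 0 1%:M) ->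
  flag_basis l b a2 (entry (block_mx U (U *m w) 0 1%:M)).
Proof.
move=> basis basis2; split=> [||i j].
- by rewrite /Bof totdeg_rcons mxn_bmat_rcons -/(lead _ _) lead_full.
- by exists a; rewrite -/(lead _ _) lead_block // lead_full.
- by rewrite totdeg_rcons; apply: entry_block_dl0.
Qed.

Lemma flag_basis_append_twin (l : seq (blk F)) k u1 u2 a1 a2 U
    (w : 'M_(totdeg l, 2)) :
  saturated_basis (block_mx (Bof l) 0 0 (blk_mx (BDiag k [:: u1; u2]))) a2
    (block_mx U (U *m w) 0 1%:M) ->
  saturated_basis (block_mx (Bof l) 0 0 (blk_mx (BDiag k [:: u1]))) a1
    (block_mx U (U *m col 0 w) 0 1%:M) ->
  flag_basis (rcons l (BDiag k [:: u1])) (BDiag k [:: u2]) a2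
    (entry (block_mx U (U *m w) 0 1%:M)).
Proof.
move=> basis2 basis1.
have deg1 : totdeg (rcons l (BDiag k [:: u1])) = (totdeg l + 1)%N by rewrite totdeg_rcons.
have deg2 : totdeg (rcons (rcons l (BDiag k [:: u1])) (BDiag k [:: u2])) = (totdeg l + 2)%N.
  by rewrite totdeg_rcons deg1 -addnA.
split=> [||i j].
- rewrite /Bof deg2 -/(lead _ _) lead_full.
  have -> : mxn (totdeg l + 2) (bmat (rcons (rcons l (BDiag k [:: u1])) (BDiag k [:: u2]))) =
      block_mx (Bof l) 0 0 (blk_mx (BDiag k [:: u1; u2])).
    by rewrite -mxn_bmat_rcons; apply/matrixP => i j; rewrite !mxE bmat_merge_diag.
  exact: basis2.
- exists a1; rewrite /Bof deg1 -/(lead _ _) lead_unipotent.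
  have -> : mxn (totdeg l + 1) (bmat (rcons l (BDiag k [:: u1]))) =
      block_mx (Bof l) 0 0 (blk_mx (BDiag k [:: u1])) := mxn_bmat_rcons l (BDiag k [:: u1]).
  by rewrite colE -mulmxA -colE.
rewrite deg1 deg2 => le_i lt_i lt_j.
have [lt_jl|le_lj] := ltnP j (totdeg l); first by apply: entry_block_dl0 => //; lia.
have -> : i = rshift (totdeg l) (1 : 'I_2) by rewrite /=; lia.
have -> : j = rshift (totdeg l) (0 : 'I_2) by rewrite /=; lia.
by rewrite entryE block_mxEdr mxE.
Qed.

(** * Pre-optimal forms *)

Lemma DB_qdisc n (B : 'M[F]_n) : ~~ odd n -> DB B = qdisc B.
Proof.
move=> even_n; rewrite /DB /qdisc /disc detZ.
have -> : (2 : F) ^+ n = 4 ^+ n./2.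
  by have -> : (4 : F) = 2 ^+ 2 by [rewrite -natrX]; rewrite -exprM; congr (_ ^+ _); lia.
by rewrite -[(-4)]mulN1r exprMn mulrA.
Qed.

Lemma v_qdisc n (B : 'M[F]_n) : qdisc B != 0 -> v (qdisc B) = v (\det B) + n%:Z.
Proof.
move=> D0; have /ord_qdiscE[] : ord_eq (qdisc B) (v (qdisc B)) by [].
have [p0 vp] := ord_eq_pow2 n; rewrite detZ mulf_eq0 negb_or => /andP[_ det0].
by rewrite vM // vp addrC.
Qed.

Lemma weight_plus2_kept_next d d' D D' D'' (k : int) :
  odd d' = ~~ odd d -> ord_eq D' (v D + k + 1) -> ord_eq D'' (v D' + k + 1) ->
  weight_plus2 d D D' <-> weight_kept d' D' D''.
Proof.
move=> dd' [_ vD'] [_ vD'']; rewrite /weight_plus2 /weight_kept dd'.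
by case: (odd d) => //=; have -> : odd `|v D|%N = odd `|v D''|%N by lia.
Qed.

Section PreOptimal.
Variable bs : seq (blk F).
Hypothesis bs_po : preoptimal v bs.
Local Notation blk_at m := (nth (BDiag 0 [::]) bs m).
Local Notation rank m := (totdeg (take m bs)).
Local Notation D m := (qdisc (Bof (take m bs))).
Local Notation kept m := (weight_kept (rank m) (D m) (D m.+1)).
Local Notation plus2 m := (weight_plus2 (rank m) (D m) (D m.+1)).

Lemma rankS m : (m < size bs)%N -> rank m.+1 = (rank m + blk_deg (blk_at m))%N.
Proof. by move=> lt_m; rewrite (take_nth (BDiag 0 [::]) lt_m) totdeg_rcons. Qed.

Lemma odd_rankS m k us : (m < size bs)%N -> blk_at m = BDiag k us -> size us = 1%N ->
  odd (rank m.+1) = ~~ odd (rank m).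
Proof. by move=> lt_m eq_m size1; rewrite rankS // eq_m /= size1 oddD addbT. Qed.

Lemma rank0 : rank 0 = 0%N.
Proof. by rewrite take0. Qed.

Lemma blk_at_wf m : (m < size bs)%N -> blk_wf v (blk_at m).
Proof. by case: bs_po => wf _; apply: wf. Qed.

Lemma qdisc_prefixS m : (m < size bs)%N ->
  D m.+1 = qdisc (block_mx (Bof (take m bs)) 0 0 (blk_mx (blk_at m))).
Proof. by move=> lt_m; rewrite (take_nth (BDiag 0 [::]) lt_m) /Bof totdeg_rcons mxn_bmat_rcons. Qed.

Lemma qdisc_prefix0 : D 0 = 1.
Proof. by rewrite take0; apply: disc_mx0. Qed.

Lemma qdisc_prefix_neq0 m : (m <= size bs)%N -> D m != 0.
Proof.
elim: m => [|m IH] lt_m; first by rewrite qdisc_prefix0 oner_neq0.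
have Dm : ord_eq (D m) (v (D m)) by split=> //; apply: IH (ltnW lt_m).
rewrite qdisc_prefixS //; have := blk_at_wf lt_m; case: (blk_at m) => [k us|k a b c] wf.
  by case: (ord_qdisc_block Dm (ord_qdisc_blk_diag wf)).
by case: (ord_qdisc_block Dm (ord_qdisc_blk_non wf)).
Qed.

Lemma ord_qdisc_prefix_diag m k us : (m < size bs)%N -> blk_at m = BDiag k us ->
  ord_eq (D m.+1) (v (D m) + (size us)%:Z * (k%:Z + 1)).
Proof.
move=> lt_m eq_m; have := blk_at_wf lt_m; rewrite qdisc_prefixS // eq_m => wf.
exact: ord_qdisc_block (conj (qdisc_prefix_neq0 (ltnW lt_m)) erefl) (ord_qdisc_blk_diag wf).
Qed.

Lemma plus2_kept_next m k us us' : (m.+1 < size bs)%N ->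
  blk_at m = BDiag k us -> blk_at m.+1 = BDiag k us' -> size us = 1%N -> size us' = 1%N ->
  plus2 m <-> kept m.+1.
Proof.
move=> lt_m eq_m eq_m1 size1 size1'; have := ord_qdisc_prefix_diag lt_m eq_m1.
have := ord_qdisc_prefix_diag (ltnW lt_m) eq_m; rewrite size1 size1' !mul1r !addrA.
exact: weight_plus2_kept_next (odd_rankS (ltnW lt_m) eq_m size1).
Qed.

Lemma xi0_prefix m : (m <= size bs)%N -> ~~ odd (rank m) ->
  xi_val v (DB (Bof (take m bs))) 0 <-> ~ sq_mod4 (D m).
Proof. by move=> lt_m even_m; rewrite DB_qdisc // xi0P //; apply: qdisc_prefix_neq0. Qed.

Lemma v_det_prefix m : (m <= size bs)%N ->
  v (D m) = v (\det (Bof (take m bs))) + (rank m)%:Z.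
Proof. by move=> lt_m; rewrite v_qdisc //; apply: qdisc_prefix_neq0. Qed.

Lemma diag_deg_le2 m : (m < size bs)%N -> blk_isdiag (blk_at m) -> (blk_deg (blk_at m) <= 2)%N.
Proof.
move=> lt_m diag_m; have [_ [[sum_le2 _] _]] := bs_po.
apply: leq_trans (sum_le2 (blk_k (blk_at m))).
rewrite (big_nth (BDiag 0 [::])) big_mkord (bigD1 (Ordinal lt_m)) /= ?diag_m ?eqxx //.
exact: leq_addr.
Qed.

Lemma diag_deg_sum_le2 m m' : (m < m' < size bs)%N ->
  blk_isdiag (blk_at m) -> blk_isdiag (blk_at m') -> blk_k (blk_at m) = blk_k (blk_at m') ->
  (blk_deg (blk_at m) + blk_deg (blk_at m') <= 2)%N.
Proof.
move=> /andP[mm' lt_m'] diag_m diag_m' eq_k; have [_ [[sum_le2 _] _]] := bs_po.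
apply: leq_trans (sum_le2 (blk_k (blk_at m))); have lt_m := ltn_trans mm' lt_m'.
rewrite (big_nth (BDiag 0 [::])) big_mkord (bigD1 (Ordinal lt_m)) /= ?diag_m ?eqxx //.
rewrite leq_add2l (bigD1 (Ordinal lt_m')) /= ?diag_m' ?eq_k ?eqxx //= ?leq_addr //.
by rewrite -val_eqE /= gtn_eqF.
Qed.

Variant blk_spec : blk F -> Prop :=
| BlkDiag1 k u of unit_o v u : blk_spec (BDiag k [:: u])
| BlkDiag2 k u w of unit_o v u & unit_o v w : blk_spec (BDiag k [:: u; w])
| BlkNon k a b c of blk_wf v (BNon k a b c) : blk_spec (BNon k a b c).

Lemma blk_atP m : (m < size bs)%N -> blk_spec (blk_at m).
Proof.
move=> lt_m; have := diag_deg_le2 lt_m; have := blk_at_wf lt_m.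
case: (blk_at m) => [k us|k a b c wf _]; last exact: BlkNon.
case=> us0 us_unit /(_ isT); case: us us0 us_unit => [//|u [|w [|//]]] _ us_unit _.
  by apply: BlkDiag1; apply: us_unit; rewrite inE.
by apply: BlkDiag2; apply: us_unit; rewrite !inE eqxx ?orbT.
Qed.

Section ConsecutiveBlocks.
Variable m : nat.
Hypothesis lt_m : (m.+1 < size bs)%N.

Let lt_m' : (m < size bs)%N. Proof. exact: ltnW. Qed.

Lemma non_non_level k a b c k' a' b' c' :
  blk_at m = BNon k a b c -> blk_at m.+1 = BNon k' a' b' c' -> (k <= k')%N.
Proof.
move=> eq_m eq_m1; have [_ [_ [/(_ m.+1 m.+2 isT (leqnn _) lt_m)]]] := bs_po.
by rewrite /= eq_m eq_m1 /= => -[_ /(_ isT isT)].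
Qed.

Lemma diag_non_level k us k' a b c :
  blk_at m = BDiag k us -> blk_at m.+1 = BNon k' a b c ->
  (k < k')%N /\ (k' = k.+1 -> size us = 1%N /\ ~ plus2 m).
Proof.
move=> eq_m eq_m1; have [_ [_ [po2 [_ [_ [po5 _]]]]]] := bs_po.
have := po5 m.+1 isT lt_m; have := po2 m.+1 m.+2 isT (leqnn _) lt_m.
rewrite /= eq_m eq_m1 /= => -[_ _ /(_ isT isT)[le_k k'_gt0] _] po5_m.
split=> [|eq_k]; first by lia.
have [|size1 cond] := po5_m isT isT _; first by lia.
have odd_rank := odd_rankS lt_m' eq_m size1.
split=> //; rewrite /weight_plus2; case: cond => -[].
  rewrite odd_rank negbK => /[dup] odd_m -> odd_det sqD.
  have := sq_mod4_even (qdisc_prefix_neq0 lt_m') sqD; have := v_det_prefix lt_m'.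
  by lia.
rewrite odd_rank => /[dup] even_m /negPf->; case: (posnP m) => [m0|m_gt0] not_xi0.
  by rewrite m0 qdisc_prefix0; have [_ ->] := ord_eq1.
move=> odd_D; apply: not_xi0 => //; apply/(xi0_prefix (ltnW lt_m') even_m) => sqD.
by have := sq_mod4_even (qdisc_prefix_neq0 (ltnW lt_m')) sqD; rewrite odd_D.
Qed.

Lemma non_diag_level k a b c k' us :
  blk_at m = BNon k a b c -> blk_at m.+1 = BDiag k' us ->
  (k <= k'.+1)%N /\ (k = k'.+1 -> size us = 1%N -> ~ kept m.+1).
Proof.
move=> eq_m eq_m1; have [_ [_ [po2 [_ [po4 _]]]]] := bs_po.
have := po4 m.+2 isT lt_m; have := po2 m.+1 m.+2 isT (leqnn _) lt_m.
rewrite /= eq_m eq_m1 /= => -[_ _ _ /(_ isT isT) le_k] po4_m.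
split=> [|eq_k size1]; first by lia.
have odd_rank := odd_rankS lt_m eq_m1 size1.
have [||[_ cond]] := po4_m _ isT isT; [by lia|by rewrite size1|].
rewrite /weight_kept; case: cond => -[].
  rewrite odd_rank negbK => /[dup] odd_m1 -> even_det; have := v_det_prefix lt_m.
  by lia.
rewrite odd_rank => /[dup] even_m1 /negPf->.
by move/(xi0_prefix lt_m' even_m1).
Qed.

Lemma diag_diag_level k us k' us' :
  blk_at m = BDiag k us -> blk_at m.+1 = BDiag k' us' ->
  [/\ (k <= k')%N, k = k' -> size us = 1%N /\ size us' = 1%N &
      k' = k.+1 -> size us = 1%N -> size us' = 1%N -> kept m.+1 -> ~ plus2 m].
Proof.
move=> eq_m eq_m1; have [_ [_ [po2 [_ [_ [_ po6]]]]]] := bs_po.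
have := po6 m.+1 isT lt_m; have := po2 m.+1 m.+2 isT (leqnn _) lt_m.
rewrite /= eq_m eq_m1 /= => -[/(_ isT isT) le_k _ _ _] po6_m.
split=> [//|eq_k|eq_k size1 size1'].
  have := @diag_deg_sum_le2 m m.+1; have := blk_at_wf lt_m; have := blk_at_wf lt_m'.
  by rewrite ltnSn lt_m eq_m eq_m1 eq_k => -[us_gt0 _] [us'_gt0 _] /(_ isT isT isT erefl) /=; lia.
have odd_rank := odd_rankS lt_m' eq_m size1.
have [_ vD1] := ord_qdisc_prefix_diag lt_m' eq_m; have [_ vD2] := ord_qdisc_prefix_diag lt_m eq_m1.
rewrite size1 mul1r in vD1; rewrite size1' mul1r in vD2.
rewrite /weight_kept /weight_plus2 odd_rank.
have [odd_m _ /=|_ /=] := boolP (odd (rank m)); last by lia.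
have even_m1 : ~~ odd (rank m.+1) by rewrite odd_rank odd_m.
have xi0 := po6_m even_m1 isT isT (etrans eq_k (esym (addn1 k))).
by move/(xi0_prefix lt_m' even_m1): xi0.
Qed.

End ConsecutiveBlocks.

Lemma diag2_conditions m k us :
  (m < size bs)%N -> blk_at m = BDiag k us -> size us = 2%N ->
  (odd (rank m) -> odd `|(v (D m) - k%:Z)%R|%N) /\
  (~~ odd (rank m) -> ~ sq_mod4 (D m) /\ ~ sq_mod4 (D m.+1)).
Proof.
move=> lt_m eq_m size2; have [_ [_ [_ [po3 _]]]] := bs_po.
have := po3 m.+1 isT lt_m; rewrite /= eq_m /= size2 => /(_ isT erefl) [_].
have -> : odd (rank m.+1) = odd (rank m) by rewrite rankS // eq_m /= size2 oddD addbF.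
case=> [[even_m [xi_m xi_m1]]|[odd_m even_det]].
  split=> [odd_m|_]; first by rewrite odd_m in even_m.
  split; first exact/(xi0_prefix (ltnW lt_m) even_m).
  by apply/(xi0_prefix lt_m _); rewrite // rankS // eq_m /= size2 oddD addbF.
split=> [_|/negP[]//]; have := v_det_prefix (ltnW lt_m).
by move: even_det; rewrite /=; lia.
Qed.

Definition capped (m : nat) (a : nat -> nat) : Prop :=
  if m is m'.+1 then
    match blk_at m' with
    | BNon k _ _ _ => weights_le (rank m) a k
    | BDiag k us => weights_le (rank m) a k.+2 /\
        (size us = 2%N \/ ~ plus2 m' -> weights_le (rank m) a k.+1)
    end
  else True.

Lemma weights_leW n a c c' : weights_le n a c -> (c <= c')%N -> weights_le n a c'.
Proof. by move=> a_le cc' i /a_le /leq_trans; apply. Qed.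

Lemma capped_non m k x y z a :
  (m < size bs)%N -> blk_at m = BNon k x y z -> capped m a -> weights_le (rank m) a k.
Proof.
case: m => [|m] lt_m eq_m; first by rewrite rank0.
rewrite /capped; case eq_m0 : (blk_at m) => [k0 us|k0 ? ? ?]; last first.
  by move=> /weights_leW; apply; apply: non_non_level eq_m0 eq_m.
have [lt_k next_k] := diag_non_level lt_m eq_m0 eq_m; move=> [le2 le1].
have [eq_k|neq_k] := eqVneq k k0.+1; last by apply: weights_leW le2 _; lia.
by rewrite eq_k; apply: le1; right; case: (next_k eq_k).
Qed.

Lemma capped_diag m k us a :
  (m < size bs)%N -> blk_at m = BDiag k us -> size us = 2%N \/ ~ kept m -> capped m a ->
  weights_le (rank m) a k.+1.
Proof.
case: m => [|m] lt_m eq_m raised; first by rewrite rank0.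
rewrite /capped; case eq_m0 : (blk_at m) => [k0 us0|k0 ? ? ?]; last first.
  have [le_k _] := non_diag_level lt_m eq_m0 eq_m.
  by move=> /weights_leW; apply.
have [le_k same_k _] := diag_diag_level lt_m eq_m0 eq_m; move=> [le2 le1].
have [eq_k|neq_k] := eqVneq k0 k; last by apply: weights_leW le2 _; lia.
rewrite -eq_k; apply: le1; right; subst k0.
have [size1 size1'] := same_k erefl; case: raised => [|not_kept]; first by rewrite size1'.
by move/(plus2_kept_next lt_m eq_m0 eq_m size1 size1').
Qed.

Lemma capped_kept m k us a :
  (m < size bs)%N -> blk_at m = BDiag k us -> size us = 1%N -> kept m ->
  (forall m' us', m = m'.+1 -> blk_at m' = BDiag k us' -> False) -> capped m a ->
  weights_le (rank m) a k.
Proof.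
case: m => [|m] lt_m eq_m size1' kept_m not_twin; first by rewrite rank0.
rewrite /capped; case eq_m0 : (blk_at m) => [k0 us0|k0 ? ? ?]; last first.
  have [le_k next_k] := non_diag_level lt_m eq_m0 eq_m.
  have [eq_k|neq_k] := eqVneq k0 k.+1; first by case: (next_k eq_k size1').
  by move=> /weights_leW; apply; lia.
have [le_k _ next_k] := diag_diag_level lt_m eq_m0 eq_m; move=> [le2 le1].
have lt_k : (k0 < k)%N.
  rewrite ltn_neqAle le_k andbT; apply/eqP => eq_k.
  by apply: (not_twin m us0); rewrite // -eq_k.
have [eq_k|neq_k] := eqVneq k k0.+1; last by apply: weights_leW le2 _; lia.
rewrite eq_k; apply: le1; have := blk_atP (ltnW lt_m); rewrite eq_m0 => us0_spec.
have [size1|size2] : size us0 = 1%N \/ size us0 = 2%N; last by left.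
  by inversion us0_spec; [left|right].
by right; apply: next_k.
Qed.


Definition capped_basis (m : nat) : Prop :=
  exists U a, saturated_basis (Bof (take m bs)) a U /\ capped m a.

Definition capped_flag (m : nat) : Prop :=
  exists u a, flag_basis (take m bs) (blk_at m) a u /\ capped m.+1 a.

Lemma capped_basis0 : capped_basis 0.
Proof.
exists 1%:M, (fun=> 0%N); split=> //; split; first exact: in_GLo1.
rewrite take0; split; first by apply/matrixP; case.
  by split; [case|split; case].
case=> // _ _; rewrite big_ord0 disc_mx0.
have [n0 v1] := ord_eq1; split=> //; apply: Or31; split=> //.
by rewrite -(expr1n _ 2); apply: sq_mod4_sqr.
Qed.

Lemma capped_basisS m : (m < size bs)%N -> capped_flag m -> capped_basis m.+1.
Proof.
move=> lt_m [u [a [[basis _ _] cap_a]]]; rewrite -(take_nth _ lt_m) in basis.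
by exists (mxn _ u), a.
Qed.

Lemma extend_le d a c c' n : weights_le d a c -> (c <= c')%N -> weights_le n (extend d a c) c'.
Proof.
by move=> a_le cc' i _; rewrite /extend; case: ltnP => // /a_le /leq_trans; apply.
Qed.

Lemma capped_flag_append m b a l U w :
  blk_at m = b -> saturated_basis (Bof (take m bs)) a U -> weights_le (rank m) a l ->
  saturated_basis (block_mx (Bof (take m bs)) 0 0 (blk_mx b)) (extend (rank m) a l)
    (block_mx U (U *m w) 0 1%:M) ->
  match b with
  | BNon k _ _ _ => (l <= k)%N
  | BDiag k us => (l <= k.+2)%N /\ (size us = 2%N \/ ~ plus2 m -> (l <= k.+1)%N)
  end -> capped_flag m.
Proof.
move=> eq_m basis a_le basis' l_le.
exists (entry (block_mx U (U *m w) 0 1%:M)), (extend (rank m) a l).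
rewrite /capped eq_m; split; first exact: flag_basis_append basis basis'.
case: b l_le {eq_m w basis'} => [k us [le2 le1]|k ? ? ? le_l]; last exact: extend_le a_le le_l.
by split=> [|/le1 le_k1]; apply: extend_le a_le _.
Qed.

Lemma capped_flag_non m k x y z :
  (m < size bs)%N -> blk_at m = BNon k x y z -> capped_basis m -> capped_flag m.
Proof.
move=> lt_m eq_m [U [a [basis cap_a]]]; have a_le := capped_non lt_m eq_m cap_a.
have := blk_at_wf lt_m; rewrite eq_m => wf.
have [w basis'] := saturated_basis_append_plane basis (blk_non_sym k x y z) a_le
  (blk_non_diag wf) (blk_non_entry wf) (ord_qdisc_blk_non wf) (sq_mod4_blk_non wf).
exact: capped_flag_append eq_m basis a_le basis' (leqnn k).
Qed.

Lemma capped_flag_diag2 m k u1 u2 :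
  (m < size bs)%N -> blk_at m = BDiag k [:: u1; u2] -> capped_basis m -> capped_flag m.
Proof.
move=> lt_m eq_m [U [a [basis cap_a]]]; have := blk_at_wf lt_m; rewrite eq_m => -[_ us_unit].
have a_le := capped_diag lt_m eq_m (or_introl erefl) cap_a.
have [parity nsq] := diag2_conditions lt_m eq_m erefl.
pose c := \row_(i < 2) (2 ^+ k * [:: u1; u2]`_i).
have c_ord j : ord_eq (c 0 j) k.
  by rewrite mxE; apply: ord_eq_pow2_unit; apply: us_unit; apply: mem_nth.
have [|w basis'] := saturated_basis_append_level basis c_ord a_le parity.
  by move=> /nsq; rewrite qdisc_prefixS // eq_m blk_mx_diag.
rewrite -(blk_mx_diag k [:: u1; u2]) in basis'.
by apply: capped_flag_append eq_m basis a_le basis' _; split=> // _; lia.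
Qed.

Section DegreeOne.
Variables (m k : nat) (u : F).
Hypotheses (lt_m : (m < size bs)%N) (eq_m : blk_at m = BDiag k [:: u]).
Let c : 'rV[F]_1 := \row_i (2 ^+ k * [:: u]`_i).

Let c_ord : ord_eq (c 0 0) k.
Proof.
have := blk_at_wf lt_m; rewrite eq_m mxE => -[_ us_unit].
by apply: ord_eq_pow2_unit; apply: us_unit; rewrite inE.
Qed.

Let D_next : D m.+1 = append_disc (rank m) (D m) (c 0 0).
Proof. by rewrite qdisc_prefixS // eq_m blk_mx_diag qdisc_append_diag1. Qed.

Let blk_mx_c : blk_mx (BDiag k [:: u]) = diag_mx c.
Proof. exact: blk_mx_diag. Qed.

Lemma capped_flag_raised : ~ kept m -> capped_basis m -> capped_flag m.
Proof.
move=> not_kept [U [a [basis cap_a]]].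
have a_le := capped_diag lt_m eq_m (or_intror not_kept) cap_a.
have [plus2_m|not_plus2] := classic (plus2 m).
  have plus2_c := plus2_m; rewrite D_next in plus2_c.
  have [x x_corr] := corrects_plus2_basis basis c_ord plus2_c.
  have basis' := saturated_basis_append_plus2 basis c_ord plus2_c a_le x_corr.
  rewrite -blk_mx_c in basis'.
  have a_le2 := weights_leW a_le (leqnSn k.+1).
  by apply: capped_flag_append eq_m basis a_le2 basis' _; split=> // -[].
rewrite D_next in not_kept not_plus2.
have [x basis'] := saturated_basis_append_plus1 basis c_ord not_kept not_plus2 a_le.
rewrite -blk_mx_c in basis'.
by apply: capped_flag_append eq_m basis a_le basis' _; split=> // _; lia.
Qed.

Lemma capped_flag_kept :
  kept m -> (forall m' us', m = m'.+1 -> blk_at m' = BDiag k us' -> False) ->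
  capped_basis m -> capped_flag m.
Proof.
move=> kept_m not_twin [U [a [basis cap_a]]].
have a_le := capped_kept lt_m eq_m erefl kept_m not_twin cap_a.
rewrite D_next in kept_m; have [x basis'] := saturated_basis_append_kept basis c_ord kept_m a_le.
rewrite -blk_mx_c in basis'.
by apply: capped_flag_append eq_m basis a_le basis' _; split=> [|_]; lia.
Qed.

End DegreeOne.

(* If two successive blocks of degree 1 have the same level and the weight of the
   first rises to [k + 2], the second alone would keep the weight [k]; correcting both
   from the lattice before them gives the weights [(k + 1, k + 1)]. *)
Lemma capped_flag_twin m k u1 u2 :
  (m.+1 < size bs)%N -> blk_at m = BDiag k [:: u1] -> blk_at m.+1 = BDiag k [:: u2] ->
  kept m.+1 -> capped_basis m -> capped_flag m.+1.
Proof.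
move=> lt_m eq_m eq_m1 /(plus2_kept_next lt_m eq_m eq_m1 erefl erefl) plus2_m.
move=> [U [a [basis cap_a]]]; have lt_m' := ltnW lt_m.
have D1_ord := ord_qdisc_prefix_diag lt_m' eq_m; rewrite mul1r addrA in D1_ord.
have not_kept := weight_plus2_not_kept (saturated_basis_Delta basis) D1_ord plus2_m.
have a_le := capped_diag lt_m' eq_m (or_intror not_kept) cap_a.
pose c := \row_(i < 2) (2 ^+ k * [:: u1; u2]`_i).
have c_ord j : ord_eq (c 0 j) k.
  have := blk_at_wf lt_m'; have := blk_at_wf lt_m; rewrite eq_m eq_m1 => -[_ u2_unit] [_ u1_unit].
  rewrite mxE; apply: ord_eq_pow2_unit.
  by case: (ord2P j) => ->; [apply: u1_unit|apply: u2_unit]; rewrite inE.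
have blk_c0 : blk_mx (BDiag k [:: u1]) = diag_mx (const_mx (c 0 0) : 'rV_1).
  by rewrite blk_mx_diag; congr diag_mx; apply/rowP => j; rewrite !mxE ord1.
have [|w [basis2 basis1]] := saturated_basis_append_twin basis c_ord _ a_le.
  by rewrite qdisc_prefixS // eq_m blk_c0 qdisc_append_diag1 mxE in plus2_m.
exists (entry (block_mx U (U *m w) 0 1%:M)), (extend (rank m) a k.+1); split.
  rewrite (take_nth (BDiag 0 [::]) lt_m') eq_m eq_m1.
  rewrite -(blk_mx_diag k [:: u1; u2]) in basis2; rewrite -blk_c0 in basis1.
  exact: flag_basis_append_twin basis2 basis1.
rewrite /capped eq_m1; split=> [|_]; [apply: extend_le a_le (leqnSn _)|exact: extend_le a_le _].
Qed.

Lemma capped_flag_diag1 m k u :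
  (m < size bs)%N -> blk_at m = BDiag k [:: u] -> (forall j, (j <= m)%N -> capped_basis j) ->
  capped_flag m.
Proof.
move=> lt_m eq_m bases; case: (classic (kept m)) => [kept_m|not_kept]; last first.
  exact: capped_flag_raised lt_m eq_m not_kept (bases m (leqnn m)).
case: (classic (exists m' us', m = m'.+1 /\ blk_at m' = BDiag k us')); last first.
  move=> no_twin; apply: capped_flag_kept lt_m eq_m kept_m _ (bases m (leqnn m)).
  by move=> m' us' def_m eq_m'; apply: no_twin; exists m', us'.
move=> [m' [us' [def_m eq_m']]]; subst m.
have [_ /(_ erefl)[size1 _] _] := diag_diag_level lt_m eq_m' eq_m.
case: us' size1 eq_m' => [|u' [|]] // _ eq_m'.
exact: capped_flag_twin lt_m eq_m' eq_m kept_m (bases m' (leqnSn m')).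
Qed.

Lemma capped_flag_all m : (m < size bs)%N -> capped_flag m.
Proof.
elim/ltn_ind: m => m IH lt_m.
have bases j : (j <= m)%N -> capped_basis j.
  case: j => [_|j lt_jm]; first exact: capped_basis0.
  by have lt_j := ltn_trans lt_jm lt_m; apply: capped_basisS lt_j (IH j lt_jm lt_j).
case: {-1}(blk_at m) / (blk_atP lt_m) (erefl (blk_at m)) => [k u _|k u w _ _|k a b c _] eq_m.
- exact: capped_flag_diag1 lt_m eq_m bases.
- exact: capped_flag_diag2 lt_m eq_m (bases m (leqnn m)).
- exact: capped_flag_non lt_m eq_m (bases m (leqnn m)).
Qed.

End PreOptimal.

Lemma saturated_basis_optimal n (B U : 'M[F]_n) a :
  saturated_basis B a U -> optimal v (U^T *m B *m U).
Proof.
move=> [_ UBU_sat]; exists (fun i => a i); split; first exact: saturated_GK.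
by case: UBU_sat.
Qed.

End Unramified2adic.

Theorem theorem4p1 (F : fieldType) (v : F -> int) (Hv : unram2adic v)
  (bs : seq (blk F)) (Hr : (0 < size bs)%N)
  (HB : in_Hn v (Bof bs)) (Hpo : preoptimal v bs) :
  exists u : nat -> nat -> F,
    [/\ in_GLo v (mxn (totdeg bs) u),
        optimal v ((mxn (totdeg bs) u)^T *m Bof bs *m mxn (totdeg bs) u),
        (forall i j, (totdeg (take (size bs).-1 bs) <= i)%N -> (i < totdeg bs)%N ->
                     (j < totdeg (take (size bs).-1 bs))%N -> u i j = 0),
        in_GLo v (mxn (totdeg (take (size bs).-1 bs)) u) &
        optimal v ((mxn (totdeg (take (size bs).-1 bs)) u)^T *m
                   Bof (take (size bs).-1 bs) *m mxn (totdeg (take (size bs).-1 bs)) u)].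
Proof.
have lt_last : ((size bs).-1 < size bs)%N by rewrite prednK.
have [u [a [[basis [a' prefix_basis] block_zero] _]]] := capped_flag_all Hv Hpo lt_last.
rewrite -(take_nth _ lt_last) prednK // take_size in basis block_zero.
exists u; split=> //.
- by case: basis.
- exact: (saturated_basis_optimal Hv basis).
- by case: prefix_basis.
- exact: (saturated_basis_optimal Hv prefix_basis).
Qed.
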